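(* Let $X$ be a Polish space and let $G$ be a locally finite one-ended Borel graph on $X$. Then $G$ admits a connected toast generically, i.e. there is a $G$-invariant comeagre Borel set $X'\subseteq X$ such that there exists a connected toast for the graph $G|_{X'}$.
   Context: A Borel graph $G$ on a Polish space $X$ is a (simple, undirected) graph with vertex set $X$ whose edge set is a Borel subset of $X^2$. A connected graph is one-ended if for every finite set $F$ of vertices the induced subgraph on the complement of $F$ has exactly one infinite connected component; a non-connected graph is one-ended if each of its connected components is. A set is $G$-invariant if it is a union of connected components of $G$; $G|_{X'}$ is the induced subgraph. Toasts. $X^{<\omega}$ is the (standard Borel) space of finite subsets of $X$. For $K\subseteq X$, $E(K)$ is the set of edges of the subgraph induced on $K$, and $B_1(K)$ is the set of vertices at graph distance at most $1$ from $K$. A Borel collection $\mathcal{T}\subset X^{<\omega}$ is a toast for $G$ if (T1) $\bigcup_{K\in\mathcal{T}}E(K)=E(G)$, and (T2) for every pair of distinct $K,L\in\mathcal{T}$, either $B_1(K)\cap L=\emptyset$, or $B_1(K)\subseteq L$, or $B_1(L)\subseteq K$. The toast is connected if (T3) for every $K\in\mathcal{T}$ the induced subgraph on $K\setminus\bigcup_{K\supsetneq L\in\mathcal{T}}L$ is connected. The same definitions apply with $X$ replaced by $X'$ and $G$ by $G|_{X'}$. *)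

(* Defs.v *)
From HB Require Import structures.
From Stdlib Require Export Relation_Operators.
From mathcomp Require Export all_boot all_order all_algebra.
From mathcomp Require Export all_classical all_reals all_analysis.

Set Implicit Arguments.
Unset Strict Implicit.
Unset Printing Implicit Defensive.

Import Order.TTheory GRing.Theory Num.Theory.

Local Open Scope classical_set_scope.
Local Open Scope ring_scope.

Section DescriptiveSetTheory.

Definition separable (X : topologicalType) :=
  exists2 D : set X, countable D & dense D.

Definition metric_on (R : realType) (X : Type) (d : X -> X -> R) :=
  [/\ forall x y, 0 <= d x y,
      forall x y, d x y = 0 <-> x = y,
      forall x y, d x y = d y x
    & forall x y z, d x z <= d x y + d y z].

Definition induces_topology (R : realType) (X : topologicalType)
    (d : X -> X -> R) :=
  forall (x : X) (A : set X),
    nbhs x A <-> exists2 e : R, 0 < e & [set y | d x y < e] `<=` A.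

Definition complete_metric (R : realType) (X : topologicalType)
    (d : X -> X -> R) :=
  forall u : nat -> X,
    (forall e : R, 0 < e -> exists N : nat,
       forall m n : nat, (N <= m)%N -> (N <= n)%N -> d (u m) (u n) < e) ->
    exists l : X, u @ \oo --> l.

(* The library's complete (pseudo)metric structures carry a base point, which
   would exclude the empty space. *)
Definition polish (R : realType) (X : topologicalType) :=
  separable X /\
  exists d : X -> X -> R,
    [/\ metric_on d, induces_topology d & complete_metric d].

Definition borel (X : topologicalType) : set (set X) := <<s @open X >>.

Definition nowhere_dense (X : topologicalType) (A : set X) :=
  interior (closure A) = set0.

Definition meagre (X : topologicalType) (A : set X) :=
  exists2 F : nat -> set X,
    forall n, nowhere_dense (F n) & A = \bigcup_n F n.

Definition comeagre (X : topologicalType) (A : set X) := meagre (~` A).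

(* The space of finite subsets of X carries the quotient Borel structure: it is
   the image of the disjoint union of the powers X^n, n : nat, under the maps
   (x_0, ..., x_(n-1)) |-> {x_0, ..., x_(n-1)}, and a collection of finite sets
   is Borel iff its preimage in every X^n is. *)
Definition borel_collection (X : topologicalType) (T : set (set X)) :=
  forall n : nat, borel [set x : {ptws 'I_n -> X} | T (range x)].

End DescriptiveSetTheory.

(* A graph is given by its vertex set V and its edge set E, a symmetric
   irreflexive subset of V `*` V. *)
Section Graphs.
Variable X : Type.
Implicit Types (E : set (X * X)) (V K A : set X).

Definition induced E K : set (X * X) := E `&` (K `*` K).

Definition locally_finite E := forall x, finite_set [set y | E (x, y)].

Definition joined E : X -> X -> Prop :=
  clos_refl_trans X (fun x y => E (x, y)).

Definition components V E : set (set X) :=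
  [set C | exists2 x, V x & C = [set y | joined (induced E V) x y]].

(* The empty graph counts as connected. *)
Definition graph_connected V E :=
  forall x y, V x -> V y -> joined (induced E V) x y.

Definition one_ended_connected V E :=
  forall F : set X, finite_set F -> F `<=` V ->
    exists! C : set X, components (V `\` F) E C /\ infinite_set C.

Definition one_ended V E :=
  forall C, components V E C -> one_ended_connected C (induced E C).

Definition invariant V E A :=
  exists2 D : set (set X), D `<=` components V E & A = \bigcup_(C in D) C.

Definition B1 E K : set X := K `|` [set y | exists2 x, K x & E (x, y)].

End Graphs.

Section Toasts.
Variable X : topologicalType.
Implicit Types (E : set (X * X)) (V : set X) (T : set (set X)).

Definition borel_graph E :=
  [/\ forall x, ~ E (x, x),
      forall x y, E (x, y) -> E (y, x)
    & borel E].

(* When V is Borel, the Borel collections of finite subsets of V are the Borel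
   collections of finite subsets of X all of whose members lie in V. *)
Definition toast V E T :=
  [/\ forall K, T K -> finite_set K /\ K `<=` V,
      borel_collection T,
      \bigcup_(K in T) induced E K = E
    & forall K L, T K -> T L -> K <> L ->
        [\/ B1 E K `&` L = set0, B1 E K `<=` L | B1 E L `<=` K]].

Definition connected_toast V E T :=
  toast V E T /\
  forall K, T K ->
    graph_connected (K `\` \bigcup_(L in [set L | T L /\ L `<` K]) L) E.

End Toasts.

(* Main.v *)
From mathcomp Require Import lra.
Require Import Defs.

Set Implicit Arguments.
Unset Strict Implicit.
Unset Printing Implicit Defensive.

Local Open Scope classical_set_scope.

(* Build a toast in countably many stages. A member [L] added at some stage
   comes with a protected zone, a ball around [L] in which any two points of
   the outer boundary of [L] can be joined off all earlier members; later
   members must contain this zone or avoid it. Hence, if [Q] is connected and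
   respects all zones, then [Q] minus the members is still connected: paths are
   rerouted around the members they meet. Applied to a finite set and to its
   complement, this makes every finite set extendable: hull it by zones, fill
   in the finite components of the complement (one-endedness), and the result
   is an admissible new member, again with a protected zone.

   At one stage all admissible finite sets [K] that are isolated inside an open
   set [W] (no further point of [W] within a large distance) are added; there
   are countably many choices of the parameters, so by the Baire category
   theorem one of them handles a given ball radius for nonmeagrely many points
   of a given basic open set. Dovetailing over radii and basic open sets, the
   set of points all of whose balls are contained in a member is comeagre, and
   it is invariant.

   Borelness of everything rests on a Borel enumeration of the components,
   i.e. on the theorem that the projection of a Borel set with finite sections
   is Borel. This is proved by writing Borel sets as projections of closed
   relations with compact sections, separating the resulting analytic sets
   following Novikov, and applying Koenig's lemma. *)

(** * Borel sets as projections of closed relations *)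

Section BorelSets.
Variable X : topologicalType.
Implicit Types (A B : set X) (P Q : X -> Prop).

Lemma borel_open A : open A -> borel A.
Proof. by move=> oA; apply: sub_sigma_algebra. Qed.

Lemma borel_setC A : borel A -> borel (~` A).
Proof. by move=> bA; rewrite -setTD; apply: sigma_algebraCD. Qed.

Lemma borel_closed A : closed A -> borel A.
Proof.
move=> cA; rewrite -[A]setCK; apply: borel_setC; apply: borel_open.
exact: closed_openC.
Qed.

Lemma borel_cst (b : Prop) : borel [set _ : X | b].
Proof.
have [hb|hb] := pselect b.
  have -> : [set _ : X | b] = setT by apply/seteqP; split.
  by apply: borel_open; exact: openT.
have -> : [set _ : X | b] = set0 by apply/seteqP; split.
by apply: borel_open; exact: open0.
Qed.

Lemma borel_not P : borel [set x | P x] -> borel [set x | ~ P x].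
Proof. exact: borel_setC. Qed.

Lemma borel_exists (I : countType) (P : I -> X -> Prop) :
  (forall i, borel [set x | P i x]) -> borel [set x | exists i, P i x].
Proof.
move=> bP; pose F n := if unpickle n is Some i then [set x | P i x] else set0.
have -> : [set x | exists i, P i x] = \bigcup_n F n.
  apply/seteqP; split=> [x [i Pix]|x [n _]]; first by exists (pickle i); rewrite /F ?pickleK.
  by rewrite /F; case: unpickle => // i Pix; exists i.
apply: sigma_algebra_bigcup => n; rewrite /F.
by case: unpickle => [i|]; [exact: bP|exact: (borel_cst False)].
Qed.

Lemma borel_forall (I : countType) (P : I -> X -> Prop) :
  (forall i, borel [set x | P i x]) -> borel [set x | forall i, P i x].
Proof.
move=> bP.
have -> : [set x | forall i, P i x] = [set x | ~ exists i, ~ P i x].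
  apply/seteqP; split=> x /= => [h [i]|/forallNP h i]; first exact.
  exact: contrapT.
by apply: borel_not; apply: borel_exists => i; apply: borel_not.
Qed.

Lemma borel_or P Q :
  borel [set x | P x] -> borel [set x | Q x] -> borel [set x | P x \/ Q x].
Proof.
move=> bP bQ; have -> : [set x | P x \/ Q x] =
    [set x | exists b : bool, (if b then P else Q) x].
  by apply/seteqP; split=> x /= => [[?|?]|[[] ?]];
    [exists true|exists false|left|right].
by apply: borel_exists => -[].
Qed.

Lemma borel_and P Q :
  borel [set x | P x] -> borel [set x | Q x] -> borel [set x | P x /\ Q x].
Proof.
move=> bP bQ; have -> : [set x | P x /\ Q x] =
    [set x | forall b : bool, (if b then P else Q) x].
  apply/seteqP; split=> x /= => [[? ?] []//|h].
  by split; [exact: (h true)|exact: (h false)].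
by apply: borel_forall => -[].
Qed.

Lemma borel_imp P Q :
  borel [set x | P x] -> borel [set x | Q x] -> borel [set x | P x -> Q x].
Proof.
move=> bP bQ; have -> : [set x | P x -> Q x] = [set x | ~ P x \/ Q x].
  apply/seteqP; split=> x /=; last by case.
  by have [p|p] := pselect (P x); [right; auto|left].
by apply: borel_or => //; apply: borel_not.
Qed.

End BorelSets.

Lemma borel_ind (X : topologicalType) (S : set (set X)) :
  sigma_algebra setT S -> @open X `<=` S -> @borel X `<=` S.
Proof. by move=> sS oS; apply: smallest_sub. Qed.

Lemma borel_preimage (Y Z : topologicalType) (f : Y -> Z) (A : set Z) :
  (forall O : set Z, open O -> borel (f @^-1` O)) ->
  borel A -> borel (f @^-1` A).
Proof.
move=> fO; apply: (@borel_ind Z [set A | borel (f @^-1` A)]) => //; split.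
- exact: (borel_cst False).
- move=> B bB /=; rewrite setTD; exact: borel_setC.
- move=> F bF /=; rewrite preimage_bigcup; exact: sigma_algebra_bigcup.
Qed.

(** Dependent choice along a tree without dead ends. It supplies the branch of inseparable prefixes
    in Novikov's theorem and the infinite branch in Koenig's lemma. *)
Lemma branch (S : seq nat -> Prop) :
  S [::] -> (forall s, S s -> exists i, S (rcons s i)) ->
  exists t : nat -> nat, forall k, S (mkseq t k).
Proof.
move=> S0 SS.
have /choice[next nextP] : forall s, exists i, S s -> S (rcons s i).
  move=> s; have [/SS[i Si]|nS] := pselect (S s); first by exists i.
  by exists 0.
pose g := fix g k := if k is k'.+1 then rcons (g k') (next (g k')) else [::].
exists (fun k => next (g k)) => k.
suff -> : mkseq (fun k => next (g k)) k = g k by elim: k => //= k; exact: nextP.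
by elim: k => // k IH; rewrite mkseqS IH.
Qed.

(* A relation between points and witnesses in the Baire space [nat -> nat] is
   closed in the product topology. *)
Definition closed_rel (Z : topologicalType) (C : Z -> (nat -> nat) -> Prop) :=
  forall z t, ~ C z t -> exists O k, [/\ open O, O z
    & forall z' t', O z' -> (forall j, j < k -> t' j = t j) -> ~ C z' t'].

(** Sections of a closed relation are closed in the Baire space, so a pointwise bound on the
    witnesses makes them compact. *)
Definition bounded_rel (Z : Type) (C : Z -> (nat -> nat) -> Prop) :=
  forall z, exists g, forall t, C z t -> forall n, t n <= g n.

(* Projections of closed relations with compact sections. *)
Definition bounded_souslin (Z : topologicalType) (A : set Z) :=
  exists C, [/\ closed_rel C, bounded_rel C & forall z, A z <-> exists t, C z t].

Section BoundedSouslin.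
Variable Z : topologicalType.
Implicit Types A U : set Z.

Lemma bounded_souslin_closed A : closed A -> bounded_souslin A.
Proof.
move=> cA; exists (fun z t => A z /\ forall n, t n = 0); split.
- move=> z t; rewrite not_andP => -[nA|/existsNP[n tn]].
    exists (~` A), 0; split=> //; first exact: closed_openC.
    by move=> z' t' nA' _ [].
  exists setT, n.+1; split=> //; first exact: openT.
  by move=> z' t' _ tt' [_ /(_ n)]; rewrite tt'.
- by move=> z; exists (fun=> 0) => t [_ t0] n; rewrite t0.
- by move=> z; split=> [Az|[t []]//]; exists (fun=> 0).
Qed.

(** Entry 0 of the new witness names the index [i], and the shifted remainder witnesses [A i].
    Point-finiteness is what bounds entry 0. *)
Lemma bounded_souslin_bigcup (A : nat -> set Z) :
  (forall i, bounded_souslin (A i)) ->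
  (forall z, exists b, forall i, A i z -> i <= b) ->
  bounded_souslin (\bigcup_i A i).
Proof.
move=> /choice[C CP] fA.
exists (fun z t => C (t 0) z (t \o S)); split.
- move=> z t nC; have [cC _ _] := CP (t 0).
  have [U [k [oU Uz h]]] := cC _ _ nC.
  exists U, k.+1; split=> // z' t' Uz' tt'; rewrite tt' //.
  by apply: h => // j jk /=; rewrite tt'.
- move=> z; have [b bP] := fA z.
  have /choice[g gP] : forall i, exists g, forall t, C i z t -> forall n, t n <= g n.
    by move=> i; have [_ + _] := CP i; apply.
  exists (fun n => if n is n'.+1 then \max_(i < b.+1) g i n' else b) => t Ct.
  have tb : t 0 <= b.
    by apply: bP; have [_ _ ->] := CP (t 0); exists (t \o S).
  case=> [//|n]; apply: leq_trans (gP _ _ Ct n) _.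
  have tb' : t 0 < b.+1 by [].
  exact: (@leq_bigmax _ (fun i : 'I_b.+1 => g i n) (Ordinal tb')).
- move=> z; split=> [[i _]|[t Ct]].
    have [_ _ ->] := CP i => -[t Ct].
    by exists (fun n => if n is n'.+1 then t n' else i).
  by exists (t 0) => //; have [_ _ ->] := CP (t 0); exists (t \o S).
Qed.

(** One witness interleaves witnesses for all [A i] along [pickle]. Entries at positions that code
    no pair are pinned to 0, so that they stay bounded. *)
Lemma bounded_souslin_bigcap (A : nat -> set Z) :
  (forall i, bounded_souslin (A i)) -> bounded_souslin (\bigcap_i A i).
Proof.
move=> /choice[C CP].
exists (fun z t => (forall i, C i z (fun j => t (pickle (i, j)))) /\
  forall p, @pickle_inv (nat * nat)%type p = None -> t p = 0); split.
- move=> z t; rewrite not_andP => -[/existsNP[i nC]|/existsNP[p np]].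
    have [cC _ _] := CP i; have [U [k [oU Uz h]]] := cC _ _ nC.
    exists U, (\max_(j < k) (pickle (i, val j)).+1); split=> // z' t' Oz' tt'.
    rewrite not_andP; left; apply/existsNP; exists i.
    apply: h => // j jk; apply: tt'.
    exact: (@leq_bigmax _ (fun j : 'I_k => (pickle (i, val j)).+1) (Ordinal jk)).
  exists setT, p.+1; split=> //; first exact: openT.
  move=> z' t' _ tt' [_ h]; apply: np => /h.
  by rewrite tt'.
- move=> z.
  have /choice[g gP] : forall i, exists g, forall t, C i z t -> forall n, t n <= g n.
    by move=> i; have [_ + _] := CP i; apply.
  exists (fun p => if @pickle_inv (nat * nat)%type p is Some ij then g ij.1 ij.2 else 0).
  move=> t [Ct t0] n; case E: pickle_inv => [[i j]|]; last by rewrite t0.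
  have := @pickle_invK (nat * nat)%type n; rewrite E /= => <-.
  exact: (gP _ _ (Ct i)).
- move=> z; split=> [Az|[t [Ct _]] i _]; last first.
    by have [_ _ ->] := CP i; eexists; exact: Ct.
  have /choice[t tP] : forall i, exists t, C i z t.
    by move=> i; have [_ _ <-] := CP i; exact: Az.
  exists (fun p => if @pickle_inv (nat * nat)%type p is Some ij then t ij.1 ij.2 else 0).
  split=> [i|p ->//].
  suff -> : (fun j => match @pickle_inv (nat * nat)%type (pickle (i, j)) with
     | Some ij => t ij.1 ij.2 | None => 0 end) = t i.
    exact: tP.
  by apply/funext => j; rewrite pickleK_inv.
Qed.

Hypothesis openZ : forall U, open U -> exists V K : nat -> set Z,
  [/\ forall i, open (V i), forall i, closed (K i), forall i, V i `<=` K i,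
      forall i, K i `<=` U & U `<=` \bigcup_i V i].

Lemma bounded_souslin_open U : open U -> bounded_souslin U.
Proof.
move=> /openZ[V [K [oV cK VK KU UV]]].
(* Subtracting the earlier [V j] makes this union of closed sets point-finite: a point of [V i] lies
   in no piece of index greater than [i]. *)
have -> : U = \bigcup_i (K i `\` \bigcup_(j in [set j | j < i]) V j).
  apply/seteqP; split=> [x /UV[i _ Vix]|x [i _ [/KU]]//].
  have exV : exists i, `[< V i x >] by exists i; apply/asboolP.
  case: (ex_minnP exV) => m /asboolP Vm mmin.
  exists m => //; split; first exact: VK.
  by move=> [j /= jm /asboolP/mmin]; rewrite leqNgt jm.
apply: bounded_souslin_bigcup => [i|x].
  apply: bounded_souslin_closed; rewrite setDE; apply: closedI => //.
  by rewrite closedC; apply: bigcup_open.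
have [[i Vix]|nV] := pselect (exists i, V i x).
  exists i => j [_ nV]; rewrite leqNgt; apply/negP => ij.
  by apply: nV; exists i.
exists 0 => i [Kix _]; exfalso; apply: nV.
by have [j _ Vj] := UV _ (KU _ _ Kix); exists j.
Qed.

(** The induction carries a set together with its complement, which makes closure under complements
    trivial. *)
Lemma bounded_souslin_borel A : borel A -> bounded_souslin A.
Proof.
suff : @borel Z `<=` [set A | bounded_souslin A /\ bounded_souslin (~` A)].
  by move=> /[apply] -[].
apply: borel_ind => [|U oU]; last first.
  split; first exact: bounded_souslin_open.
  by apply: bounded_souslin_closed; rewrite closedC.
split.
- by split; [|rewrite setC0]; apply: bounded_souslin_closed; [exact: closed0|exact: closedT].
- by move=> B [bB bCB]; rewrite /= setTD setCK.
- move=> F bF; split; last first.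
    by rewrite setC_bigcup; apply: bounded_souslin_bigcap => i; case: (bF i).
  (* Each point is kept only in the first [F i] containing it, so the union becomes disjoint and in
     particular point-finite. *)
  have -> : \bigcup_i F i =
      \bigcup_i \bigcap_k (if k < i then ~` F k else F i).
    apply/seteqP; split=> [x [i _ Fix]|x [i _ /(_ i I)]]; last first.
      by rewrite ltnn => Fix; exists i.
    have exF : exists i, `[< F i x >] by exists i; apply/asboolP.
    case: (ex_minnP exF) => m /asboolP Fm mmin.
    exists m => // k _; case: ifPn => [km Fk|//].
    by move/asboolP: Fk => /mmin; rewrite leqNgt km.
  apply: bounded_souslin_bigcup => [i|x].
    by apply: bounded_souslin_bigcap => k; case: ifP => _; case: (bF k); case: (bF i).
  have [[i Fix]|nF] := pselect (exists i, F i x).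
    by exists i => j /(_ i I); case: ltnP.
  by exists 0 => i /(_ i I); rewrite ltnn => Fi; exfalso; apply: nF; exists i.
Qed.

End BoundedSouslin.

(** * Borel projections *)

(* Codes for the points of a Polish space: [P n] is a point-finite cover by
   closed sets of diameter at most [2 / n.+1]. *)
Definition closed_scheme (X : topologicalType) (P : nat -> nat -> set X) :=
  [/\ forall n i, closed (P n i),
      forall n y, exists i, P n i y,
      forall n y, exists b, forall i, P n i y -> i <= b,
      forall u : nat -> nat, (forall k, exists z, forall j, j < k -> P j (u j) z) ->
        exists y, forall j, P j (u j) y
    & forall (u : nat -> nat) y U, (forall j, P j (u j) y) -> open U -> U y ->
        exists k, forall z, (forall j, j < k -> P j (u j) z) -> U z].

Section Projection.
Variables (X : topologicalType) (P : nat -> nat -> set X).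
Hypothesis schemeP : closed_scheme P.
Hypothesis hausX : forall x y : X, x <> y -> exists U V,
  [/\ open U, open V, U x, V y & U `&` V = set0].
Implicit Type C : X -> (nat -> nat) -> Prop.

Lemma scheme_bounded y : exists g : nat -> nat, forall u : nat -> nat,
  (forall n, P n (u n) y) -> forall n, u n <= g n.
Proof.
have [_ _ P3 _ _] := schemeP.
have /choice[g gP] n := P3 n y.
by exists g => u uP n; apply: gP.
Qed.

(* The even entries of a witness code a point, the odd ones a witness. *)
Lemma closed_rel_project C' (B : X * X -> (nat -> nat) -> Prop) :
  closed_rel B ->
  C' = (fun x w => exists y, (forall n, P n (w n.*2) y) /\
          B (x, y) (fun n => w n.*2.+1)) ->
  closed_rel C'.
Proof.
have [_ _ _ P4 P5] := schemeP.
move=> cB -> x w nC.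
(* If the even entries code no point, the completeness clause of the scheme shows that some finite
   prefix is already contradictory, and that prefix is excluded. *)
have [[y yP]|ny] := pselect (exists y, forall n, P n (w n.*2) y); last first.
  have : ~ forall k, exists z, forall j, j < k -> P j (w j.*2) z.
    by move=> /(P4 (fun n => w n.*2))/ny.
  move=> /existsNP[k nk]; exists setT, k.*2; split=> //; first exact: openT.
  move=> x' w' _ ww' [y [yP _]]; apply: nk; exists y => j jk.
  by rewrite -ww' ?ltn_double.
have nB : ~ B (x, y) (fun n => w n.*2.+1) by move=> By; apply: nC; exists y.
have [W [k [oW Wxy h]]] := cB _ _ nB.
have : nbhs (x, y) W by exact: open_nbhs_nbhs.
case=> -[U V] /= [/nbhs_interior Ux /nbhs_interior Vy] UVW.
have [k' k'P] := P5 (fun n => w n.*2) y (interior V) yP (@open_interior _ V) (nbhs_singleton Vy).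
exists (interior U), (maxn k k').*2; split.
- exact: open_interior.
- exact: nbhs_singleton Ux.
move=> x' w' Ux' ww' [y' [y'P]]; apply: h.
  apply: UVW; split; first exact: interior_subset.
  apply: interior_subset; apply: k'P => j jk.
  by rewrite -ww' // ltn_double; apply: leq_trans jk (leq_maxr _ _).
move=> j jk; apply: ww'.
by rewrite ltn_Sdouble; apply: leq_trans jk (leq_maxl _ _).
Qed.

(** The witness now also codes [y]. For fixed [x] only finitely many [y] occur, so the maximum of
    their bounds is a bound. *)
Lemma bounded_souslin_project (B : set (X * X)) :
  bounded_souslin B -> (forall x, finite_set [set y | B (x, y)]) ->
  bounded_souslin [set x | exists y, B (x, y)].
Proof.
move=> [C [cC bC CB]] fB; have [_ P2 _ _ _] := schemeP.
eexists; split; first exact: (closed_rel_project cC erefl).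
- move=> x.
  have /choice[g gP] : forall y, exists g, forall w, (forall n, P n (w n.*2) y) ->
      C (x, y) (fun n => w n.*2.+1) -> forall n, w n <= g n.
    move=> y; have [g1 g1P] := scheme_bounded y; have [g2 g2P] := bC (x, y).
    exists (fun n => maxn (g1 n./2) (g2 n./2)) => w /(g1P (fun n => w n.*2)) h1 /g2P h2 n.
    rewrite leq_max -{1 3}[n]odd_double_half; case: (odd n).
      by rewrite h2 orbT.
    by rewrite h1.
  have /finite_seqP[s sB] := fB x.
  exists (fun n => \max_(y <- s) g y n) => w [y [yP Cw]] n.
  have ys : y \in s.
    have : [set y | B (x, y)] y by apply/CB; eexists; exact: Cw.
    by rewrite sB.
  apply: leq_trans (gP _ _ yP Cw n) _.
  by rewrite (big_rem y) //= leq_maxl.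
- move=> x; split=> [[y /CB[t Ct]]|[w [y [_ Cw]]]]; last first.
    by exists y; apply/CB; eexists; exact: Cw.
  have /choice[u uP] n := P2 n y.
  exists (fun n => if odd n then t n./2 else u n./2), y; split=> [n|].
    by rewrite odd_double doubleK.
  have -> // : (fun n => if odd n.*2.+1 then t n.*2.+1./2 else u n.*2.+1./2) = t.
  by apply/funext => n; rewrite /= odd_double /= uphalf_double.
Qed.

(** The witness determines its point: a long prefix of it confines the point to a small set. *)
Definition coded C := forall x t, C x t -> forall n, P n (t n.*2) x.

(** * Novikov's separation theorem *)

Section Novikov.
Variable C : nat -> X -> (nat -> nat) -> Prop.
Hypotheses (cC : forall m, closed_rel (C m)) (pC : forall m, coded (C m)).

(* [s] is a finite piece of a sequence of witnesses, one for each [C m],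
   interleaved along [pickle : nat * nat -> nat]. *)
Definition extends (m : nat) (s : seq nat) (t : nat -> nat) :=
  forall j, pickle (m, j) < size s -> t j = nth 0 s (pickle (m, j)).

(** Novikov's conclusion, localized to the witnesses that extend the finite piece [s]. *)
Definition borel_separable s := exists Q : nat -> set X,
  [/\ forall m, borel (Q m),
      forall m x t, C m x t -> extends m s t -> Q m x
    & ~ exists x, forall m, Q m x].

(** The new entry constrains the witness of a single [C m0]: unite the separating sets over its
    values for [m0], and intersect them for every other index. If the new position codes no pair,
    any value will do. *)
Lemma borel_separableS s :
  (forall i, borel_separable (rcons s i)) -> borel_separable s.
Proof.
move=> /choice[Q QP].
have ext m i (t : nat -> nat) : extends m s t ->
    (forall j, pickle (m, j) = size s -> t j = i) -> extends m (rcons s i) t.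
  move=> st ti j; rewrite size_rcons ltnS leq_eqVlt nth_rcons => /orP[/eqP e|lt].
    by rewrite e ltnn eqxx ti.
  by rewrite lt st.
case E : (@pickle_inv (nat * nat)%type (size s)) => [[m0 j0]|]; last first.
  exists (Q 0); have [bQ CQ dQ] := QP 0; split=> // m x t Cx st.
  by apply: CQ Cx _; apply: ext => // j e; rewrite -e pickleK_inv in E.
exists (fun m => [set x | if m == m0 then exists i, Q i m x else forall i, Q i m x]).
split.
- move=> m; case: eqP => _; [apply: borel_exists|apply: borel_forall] => i;
  by have [+ _ _] := QP i; apply.
- move=> m x t Cx st /=; case: eqP => [mm0|mm0].
    exists (t j0); have [_ + _] := QP (t j0); apply; [exact: Cx|].
    by apply: ext => // j e; move: E; rewrite -e pickleK_inv => -[_ ->].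
  move=> i; have [_ + _] := QP i; apply; [exact: Cx|].
  by apply: ext => // j e; move: E; rewrite -e pickleK_inv => -[].
- move=> [x Qx]; have := Qx m0; rewrite /= eqxx => -[i Qi].
  have [_ _] := QP i; apply; exists x => m.
  by have := Qx m; rewrite /=; case: eqP => [->//|_]; exact.
Qed.

(** Otherwise inseparability propagates along an infinite branch, which codes for each [m] a point
    [y m] and a witness [u m] for it. These points cannot all agree, and disjoint neighbourhoods of
    two of them separate some finite prefix of the branch. *)
Lemma novikov_separation : (~ exists x, forall m, exists t, C m x t) ->
  exists Q : nat -> set X, [/\ forall m, borel (Q m),
    forall m x t, C m x t -> Q m x & ~ exists x, forall m, Q m x].
Proof.
have [_ _ _ P4 P5] := schemeP.
move=> nC; apply: contrapT => nQ.
have [|s|t tP] := @branch (fun s => ~ borel_separable s).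
- move=> [Q [bQ CQ dQ]]; apply: nQ; exists Q; split=> // m x t Cx.
  exact: CQ Cx _.
- by move=> ns; apply/existsNP => /borel_separableS.
pose u (m j : nat) := t (pickle (m, j)).
have extu m k t' : extends m (mkseq t k) t' ->
    forall j, pickle (m, j) < k -> t' j = u m j.
  by move=> e j jk; rewrite e ?size_mkseq// nth_mkseq.
have bnd (m n : nat) : exists k, forall j, j < n -> pickle (m, j) < k.
  exists (\max_(j < n) (pickle (m, val j)).+1) => j jn.
  exact: (@leq_bigmax _ (fun j : 'I_n => (pickle (m, val j)).+1) (Ordinal jn)).
(* Were there no such witness, the empty set at index [m] and the whole space elsewhere would
   separate the prefix. *)
have inh m k : exists x t', C m x t' /\ extends m (mkseq t k) t'.
  apply: contrapT => h; apply: (tP k).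
  exists (fun m' => if m' == m then set0 else setT); split.
  - by move=> m'; case: eqP => _; [exact: (borel_cst False)|exact: (borel_cst True)].
  - move=> m' x t' Cx st; case: eqP => // mm; apply: h.
    by exists x, t'; rewrite -mm.
  - by case=> x /(_ m); rewrite eqxx.
have near m n : exists k, forall x t', C m x t' -> extends m (mkseq t k) t' ->
    forall j, j < n -> t' j = u m j.
  have [k kP] := bnd m n; exists k => x t' Cx e j jn.
  by apply: extu e _ _; apply: kP.
have nearP m n : exists k, forall x t', C m x t' -> extends m (mkseq t k) t' ->
    forall j, j < n -> P j (u m j.*2) x.
  have [k kP] := near m n.*2; exists k => x t' Cx e j jn.
  by rewrite -(kP _ _ Cx e) ?ltn_double//; exact: pC Cx _.
have /choice[y yP] : forall m, exists y, forall j, P j (u m j.*2) y.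
  move=> m; apply: (P4 (fun j => u m j.*2)) => n.
  have [k kP] := nearP m n; have [x [t' [Cx e]]] := inh m k.
  by exists x; exact: kP Cx e.
have small m U : open U -> U (y m) -> exists k, forall x t', C m x t' ->
    extends m (mkseq t k) t' -> U x.
  move=> oU Uy; have [n nP] := P5 (fun j => u m j.*2) _ _ (yP m) oU Uy.
  have [k kP] := nearP m n; exists k => x t' Cx e.
  exact: nP (kP _ _ Cx e).
have mono m k k' t' : k <= k' -> extends m (mkseq t k') t' -> extends m (mkseq t k) t'.
  move=> kk' e j; rewrite size_mkseq => jk.
  rewrite e ?size_mkseq ?(leq_trans jk)// !nth_mkseq //.
  exact: leq_trans jk kk'.
have Cy m : C m (y m) (u m).
  apply: contrapT => nCy; have [U [n [oU Uy h]]] := cC nCy.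
  have [k1 k1P] := small m U oU Uy; have [k2 k2P] := near m n.
  have [x [t' [Cx e]]] := inh m (maxn k1 k2).
  have e1 := mono _ _ _ _ (leq_maxl k1 k2) e.
  have e2 := mono _ _ _ _ (leq_maxr k1 k2) e.
  exact: h (k1P _ _ Cx e1) (k2P _ _ Cx e2) Cx.
have /existsNP[m ym] : ~ forall m, y m = y 0.
  by move=> h; apply: nC; exists (y 0) => m; exists (u m); rewrite -(h m).
have [U [V [oU oV Uy Vy UV]]] := hausX ym.
have [k1 k1P] := small m U oU Uy; have [k2 k2P] := small 0 V oV Vy.
apply: (tP (maxn k1 k2)).
exists (fun m' => if m' == m then U else if m' == 0 then V else setT); split.
- move=> m'; case: eqP => _; first exact: borel_open.
  by case: eqP => _; [exact: borel_open|exact: (borel_cst True)].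
- move=> m' x t' Cx e; case: eqP => [mm|_].
    rewrite mm in Cx e; exact: k1P Cx (mono _ _ _ _ (leq_maxl k1 k2) e).
  case: eqP => [mm|//]; rewrite mm in Cx e.
  exact: k2P Cx (mono _ _ _ _ (leq_maxr k1 k2) e).
- case=> x h; have : (U `&` V) x.
    split; first by have := h m; rewrite eqxx.
    have := h 0; case: eqP => // m0; exfalso; apply: ym.
    by rewrite -m0.
  by rewrite UV.
Qed.

End Novikov.

(** For fixed [s], let the [m]-th set consist of the points with a witness extending [s] whose next
    entry is at least [m]. Boundedness makes the intersection over [m] empty, so Novikov yields
    Borel supersets [Q s m] with empty intersection. They cut out, Borel in [x], a finitely
    branching tree that has an infinite branch exactly when [x] is in [A]. *)
Lemma bounded_souslin_is_borel_coded (A : set X) C :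
  closed_rel C -> bounded_rel C -> coded C ->
  (forall x, A x <-> exists t, C x t) -> borel A.
Proof.
move=> cC bC pC CA.
pose ext s t := forall j, j < size s -> t j = nth 0 s j.
have /choice[Q QP] : forall s, exists Q : nat -> set X, [/\ forall m, borel (Q m),
    forall m x t, [/\ C x t, ext s t & m <= t (size s)] -> Q m x
    & ~ exists x, forall m, Q m x].
  move=> s; apply: (@novikov_separation (fun m x t => [/\ C x t, ext s t & m <= t (size s)])).
  - move=> m x t nC.
    have [Cx|/cC[U [k [oU Ux h]]]] := pselect (C x t); last first.
      by exists U, k; split=> // z' t' /h/[apply]nC' [].
    exists setT, (size s).+1; split=> //; first exact: openT.
    move=> x' t' _ tt' [_ e mt]; apply: nC; split=> //.
      by move=> j js; rewrite -tt' ?e// ltnS ltnW.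
    by rewrite -tt'.
  - by move=> m x t [/pC].
  - case=> x h; have [g gP] := bC x.
    have [t [Cx _]] := h (g (size s)).+1.
    by rewrite ltnNge gP.
(* The closure keeps enough information to recover a witness from a branch; the second condition
   allows only finitely many [i] at each [x]. *)
pose B s i := closure [set x | exists t, C x t /\ ext (rcons s i) t] `&`
  [set x | forall m, m <= i -> Q s m x].
have bB s i : borel (B s i).
  apply: borel_and; first by apply: borel_closed; exact: closed_closure.
  apply: borel_forall => m; apply: borel_imp; first exact: borel_cst.
  by have [+ _ _] := QP s; apply.
pose path x s := forall k, k < size s -> B (take k s) (nth 0 s k) x.
have -> : A = [set x | forall n, exists s, size s = n /\ path x s].
  apply/seteqP; split=> x; last first.
    move=> h; apply/CA.
    (* Koenig's lemma: a node with arbitrarily long extensions has a child with the same property,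
       because it has finitely many children. *)
    pose good s := forall n, exists s', size s' = n /\ path x (s ++ s').
    have pcat s s' : path x (s ++ s') -> path x s.
      move=> p k ks; have := p k; rewrite size_cat nth_cat takel_cat ?ks ?ltn_addr ?(ltnW ks)//.
      exact.
    have [//|s gs|t tP] := @branch good.
      have [b bP] : exists b, forall i, B s i x -> i <= b.
        have [_ _ nQ] := QP s.
        move: nQ => /forallNP/(_ x)/existsNP[m nm].
        exists m => i [_ h']; rewrite leqNgt; apply/negP => mi.
        by apply: nm; apply: h'; apply: ltnW.
      apply: contrapT => /forallNP ng.
      have /choice[n nP] : forall i, exists n, forall s', size s' = n -> ~ path x (rcons s i ++ s').
        move=> i; have /existsNP[n nn] := ng i.
        by exists n => s' sn p; apply: nn; exists s'.
      have [s' [ss' ps']] := gs (\max_(i < b.+1) n i).+1.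
      case: s' ss' ps' => // i s' [ss'] ps'.
      have ib : i < b.+1.
        rewrite ltnS; apply: bP; have := ps' (size s).
        rewrite size_cat /= addnS ltnS leq_addr nth_cat ltnn subnn /=.
        by rewrite take_size_cat//; exact.
      have ni : n i <= size s'.
        by rewrite ss'; exact: (@leq_bigmax _ (fun i : 'I_b.+1 => n i) (Ordinal ib)).
      apply: (nP i (take (n i) s')); first by rewrite size_takel.
      apply: (pcat _ (drop (n i) s')).
      by rewrite -catA cat_take_drop cat_rcons.
    (* If the branch were no witness, closedness would exclude all witnesses sharing a prefix of [t]
       for points near [x]; yet [x] is a limit of points having such witnesses. *)
    exists t; apply: contrapT => /cC[U [k [oU Ux nC]]].
    have [s' [_ ps']] := tP k.+1 0.
    have /(_ k) := pcat _ _ ps'; rewrite size_mkseq => /(_ (ltnSn k)) [+ _].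
    have -> : rcons (take k (mkseq t k.+1)) (nth 0 (mkseq t k.+1) k) = mkseq t k.+1.
      by rewrite -take_nth ?size_mkseq// take_oversize ?size_mkseq.
    move=> /(_ U (open_nbhs_nbhs (conj oU Ux))) [x' [[t' [Cx' e]] Ux']].
    apply: nC Ux' _ Cx' => j jk.
    by rewrite e ?size_mkseq ?nth_mkseq// ltnW.
  move=> /CA[t Ct] n; exists (mkseq t n); rewrite size_mkseq; split=> // k.
  rewrite size_mkseq => kn.
  have mk : take k (mkseq t n) = mkseq t k.
    have sk : size (take k (mkseq t n)) = k by rewrite size_takel ?size_mkseq ?(ltnW kn).
    apply: (@eq_from_nth _ 0); rewrite sk ?size_mkseq// => j jk.
    by rewrite nth_take// !nth_mkseq//; exact: ltn_trans jk kn.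
  rewrite mk nth_mkseq//; split.
    apply: subset_closure; exists t; split=> // j; rewrite -mkseqS size_mkseq => jk.
    by rewrite nth_mkseq.
  move=> m mk'; have [_ + _] := QP (mkseq t k); apply; split; first exact: Ct.
    by move=> j; rewrite size_mkseq => jk; rewrite nth_mkseq.
  by rewrite size_mkseq.
apply: borel_forall => n; apply: borel_exists => s.
apply: borel_and; first exact: borel_cst.
apply: borel_forall => k; apply: borel_imp; first exact: borel_cst.
exact: bB.
Qed.

(** Interleaving a code of [x] into the witness makes the relation coded, while it stays closed and
    bounded. *)
Lemma bounded_souslin_is_borel (A : set X) : bounded_souslin A -> borel A.
Proof.
have [P1 P2 _ _ _] := schemeP.
move=> [C [cC bC CA]].
apply: (@bounded_souslin_is_borel_coded A (fun x w =>
  (forall n, P n (w n.*2) x) /\ C x (fun n => w n.*2.+1))).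
- move=> x w; rewrite not_andP => -[/existsNP[n nP]|/cC[U [k [oU Ux h]]]].
    exists (~` P n (w n.*2)), n.*2.+1; split=> //; first exact: closed_openC.
    by move=> x' w' nP' ww' [/(_ n)]; rewrite ww'.
  exists U, k.*2; split=> // x' w' Ux' ww' [_]; apply: h => // j jk.
  by apply: ww'; rewrite ltn_Sdouble.
- move=> x; have [g1 g1P] := scheme_bounded x; have [g2 g2P] := bC x.
  exists (fun n => maxn (g1 n./2) (g2 n./2)) => w [/(g1P (fun n => w n.*2)) h1 /g2P h2] n.
  rewrite leq_max -{1 3}[n]odd_double_half; case: (odd n).
    by rewrite h2 orbT.
  by rewrite h1.
- by move=> x t [].
- move=> x; split=> [/CA[t Ct]|[w [_ Cw]]]; last by apply/CA; eexists; exact: Cw.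
  have /choice[u uP] n := P2 n x.
  exists (fun n => if odd n then t n./2 else u n./2); split=> [n|].
    by rewrite odd_double doubleK.
  have -> // : (fun n => if odd n.*2.+1 then t n.*2.+1./2 else u n.*2.+1./2) = t.
  by apply/funext => n; rewrite /= odd_double /= uphalf_double.
Qed.

End Projection.

(** * Baire category and metric spaces *)

Lemma interior_mono (X : topologicalType) (A B : set X) : A `<=` B -> A° `<=` B°.
Proof. by move=> AB x /= nA; apply: filterS nA. Qed.

Lemma nowhere_dense_sub (X : topologicalType) (A B : set X) :
  A `<=` B -> nowhere_dense B -> nowhere_dense A.
Proof.
rewrite /nowhere_dense => AB B0; apply/seteqP; split=> // x Ax.
by rewrite -B0; apply: interior_mono Ax; apply: closureS.
Qed.

Lemma meagre_sub (X : topologicalType) (A B : set X) :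
  A `<=` B -> meagre B -> meagre A.
Proof.
move=> AB [F nF BF]; exists (fun n => A `&` F n).
  by move=> n; apply: nowhere_dense_sub (nF n); exact: subIsetr.
by rewrite -setI_bigcupr -BF; apply/esym/setIidPl.
Qed.

Lemma meagre_bigcup (X : topologicalType) (I : countType) (A : I -> set X) :
  (forall i, meagre (A i)) -> meagre (\bigcup_i A i).
Proof.
move=> mA.
have /choice[F FP] : forall i, exists F : nat -> set X,
    (forall n, nowhere_dense (F n)) /\ A i = \bigcup_n F n.
  by move=> i; have [F ? ?] := mA i; exists F.
exists (fun k => if unpickle k is Some (i, n) then F i n else set0).
  move=> k; case: unpickle => [[i n]|]; first by have [+ _] := FP i; apply.
  by rewrite /nowhere_dense closure0 interior0.
apply/seteqP; split=> [x [i _]|x [k _]].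
  have [_ ->] := FP i => -[n _ Fx]; exists (pickle (i, n)) => //.
  by rewrite pickleK.
case: unpickle => // -[i n] Fx; exists i => //.
by have [_ ->] := FP i; exists n.
Qed.

Lemma meagreU (X : topologicalType) (A B : set X) :
  meagre A -> meagre B -> meagre (A `|` B).
Proof.
move=> mA mB; apply: (@meagre_sub _ _ (\bigcup_(b : bool) (if b then A else B))).
  by move=> x [Ax|Bx]; [exists true|exists false].
by apply: meagre_bigcup => -[].
Qed.

Lemma nowhere_dense_meagre (X : topologicalType) (A : set X) :
  nowhere_dense A -> meagre A.
Proof. by move=> nA; exists (fun=> A) => //; rewrite bigcup_const//; exists 0. Qed.

Lemma nowhere_dense_frontier (X : topologicalType) (U : set X) :
  open U -> nowhere_dense (closure U `\` U).
Proof.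
move=> oU; apply/seteqP; split=> // x.
have cl : closed (closure U `\` U).
  by rewrite setDE; apply: closedI; [exact: closed_closure|rewrite closedC].
move/closure_id: cl => <- nx.
have [cx _] := nbhs_singleton nx.
by have [y [Uy [_]]] := cx _ nx.
Qed.

Definition baire_property (X : topologicalType) (A : set X) :=
  exists2 U, open U & meagre ((A `\` U) `|` (U `\` A)).

(** Modulo meagre sets the complement of an open set is its exterior, since the frontier is nowhere
    dense. *)
Lemma borel_baire_property (X : topologicalType) (A : set X) :
  borel A -> baire_property A.
Proof.
suff : @borel X `<=` [set A | baire_property A] by apply.
have m0 : meagre (@set0 X).
  by apply: nowhere_dense_meagre; rewrite /nowhere_dense closure0 interior0.
apply: borel_ind => [|U oU]; last by exists U => //; rewrite setDv setUid.
split.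
- by exists set0; [exact: open0|rewrite setDv setUid].
- move=> B [U oU mB] /=; rewrite setTD; exists (~` closure U).
    by rewrite openC; exact: closed_closure.
  apply: meagre_sub (meagreU mB (nowhere_dense_meagre (nowhere_dense_frontier oU))).
  move=> x [[nB /contrapT cU]|[cU /contrapT Bx]].
    by have [Ux|nU] := pselect (U x); [left; right|right].
  by left; left; split=> // Ux; apply: cU; apply: subset_closure.
- move=> F bF.
  have /choice[U UP] : forall i, exists U, open U /\ meagre ((F i `\` U) `|` (U `\` F i)).
    by move=> i; have [U ? ?] := bF i; exists U.
  exists (\bigcup_i U i); first by apply: bigcup_open => i _; case: (UP i).
  apply: (@meagre_sub _ _ (\bigcup_i ((F i `\` U i) `|` (U i `\` F i)))); last first.
    by apply: meagre_bigcup => i; case: (UP i).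
  move=> x [[[i _ Fx] nU]|[[i _ Ux] nF]]; exists i => //.
    by left; split=> // Ux; apply: nU; exists i.
  by right; split=> // Fx; apply: nF; exists i.
Qed.

(** The complement of [A] equals an open set [U] modulo a meagre set; then [A] is meagre in [U],
    which forces [U] to be empty. *)
Lemma comeagre_nonmeagre (X : topologicalType) (A : set X) :
  borel A -> (forall U, open U -> U !=set0 -> ~ meagre (A `&` U)) -> comeagre A.
Proof.
move=> /borel_setC/borel_baire_property[U oU mU] nm.
have U0 : U = set0.
  apply: contrapT => /eqP/set0P/(nm _ oU); apply; apply: meagre_sub mU.
  by move=> x [Ax Ux]; right; split=> //; apply.
by move: mU; rewrite U0 set0D setD0 setU0.
Qed.

Definition regular_base (X : topologicalType) (U K : nat -> set X) :=
  [/\ forall p, open (U p), forall p, closed (K p), forall p, U p `<=` K p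
    & forall x W, open W -> W x -> exists p, U p x /\ K p `<=` W].

Definition separated_points (X : topologicalType) := forall x y : X, x <> y ->
  exists U V, [/\ open U, open V, U x, V y & U `&` V = set0].

(** * Consequences of a complete separable metric *)

Section Metric.
Import Order.TTheory GRing.Theory Num.Theory.
Variables (R : realType) (X : topologicalType).
Local Open Scope ring_scope.
Variable d : X -> X -> R.
Hypotheses (metricd : metric_on d) (topd : induces_topology d).

Lemma open_metricP (A : set X) :
  open A <-> forall x, A x -> exists2 e : R, 0 < e & [set y | d x y < e] `<=` A.
Proof.
rewrite openE; split=> h x Ax; first by apply/topd; apply: h.
by rewrite /interior; apply/topd; apply: h.
Qed.

Lemma open_metric_ball x (e : R) : open [set y | d x y < e].
Proof.
have [_ _ _ dtri] := metricd; apply/open_metricP => y /= dxy.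
exists (e - d x y); first by rewrite subr_gt0.
move=> z /=; rewrite ltrBrDl => h; exact: le_lt_trans (dtri x y z) h.
Qed.

Lemma closed_metric_ball x (e : R) : closed [set y | d x y <= e].
Proof.
have [_ _ dsym dtri] := metricd; rewrite -openC; apply/open_metricP => y /negP.
rewrite -ltNge => dxy.
exists (d x y - e); first by rewrite subr_gt0.
move=> z /= h; apply/negP; rewrite -ltNge.
by move: h (dtri x z y); rewrite (dsym z y); lra.
Qed.

Lemma metric_refl x : d x x = 0.
Proof. by have [_ dE _ _] := metricd; apply/dE. Qed.

Lemma metric_separated : separated_points X.
Proof.
have [d0 dE dsym dtri] := metricd => x y xy.
have e0 : 0 < d x y.
  by rewrite lt_neqAle d0 andbT; apply/eqP => /esym/dE.
exists [set z | d x z < d x y / 2], [set z | d y z < d x y / 2].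
split; [exact: open_metric_ball|exact: open_metric_ball| | |].
- by rewrite /= metric_refl; lra.
- by rewrite /= metric_refl; lra.
- apply/seteqP; split=> // z [/= xz yz].
  by move: (dtri x z y); rewrite (dsym z y); lra.
Qed.

Definition radius (n : nat) : R := n.+1%:R^-1.

Lemma radius_small (e : R) : 0 < e -> exists n, radius n < e.
Proof. by move=> /ltr_add_invr[n]; rewrite add0r; exists n. Qed.

Lemma radius_gt0 n : 0 < radius n.
Proof. by rewrite invr_gt0 ltr0n. Qed.

Section Dense.
Variable q : nat -> X.
Hypothesis denseq : dense (range q).

Lemma dense_approx x (e : R) : 0 < e -> exists i, d (q i) x < e.
Proof.
have [_ dE dsym _] := metricd.
move=> e0; have /denseq : [set y | d x y < e] !=set0.
  by exists x; rewrite /= metric_refl.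
move=> /(_ (open_metric_ball x e))[z [/= xz [i _ iz]]].
by exists i; rewrite iz dsym.
Qed.

Lemma metric_regular_base : exists U K : nat -> set X, regular_base U K.
Proof.
have [_ _ dsym dtri] := metricd.
exists (fun p => if unpickle p is Some (i, m) then
    [set y | d (q i) y < radius m] else set0).
exists (fun p => if unpickle p is Some (i, m) then
    [set y | d (q i) y <= radius m] else set0).
split.
- by move=> p; case: unpickle => [[i m]|]; [exact: open_metric_ball|exact: open0].
- by move=> p; case: unpickle => [[i m]|]; [exact: closed_metric_ball|exact: closed0].
- by move=> p; case: unpickle => [[i m]|] // y /= /ltW.
- move=> x W /open_metricP/[apply] -[e e0 eW].
  have e2 : 0 < e / 2 by lra.
  have [m me] := radius_small e2; have [i ix] := dense_approx x (radius_gt0 m).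
  exists (pickle (i, m)); rewrite pickleK.
  split=> // y /= iy; apply: eW => /=.
  by move: (dtri x (q i) y); rewrite (dsym x (q i)); lra.
Qed.

Hypothesis completed : complete_metric d.

(** A cell consists of the points within [radius n] of [q i] and at distance at least [radius n]
    from all earlier centres. Non-strict inequalities keep the cells closed; overlaps are harmless,
    as any centre strictly closer than [radius n] bounds the indices. *)
Lemma metric_closed_scheme : exists P, @closed_scheme X P.
Proof.
have [_ _ dsym dtri] := metricd.
exists (fun n i => [set y | d (q i) y <= radius n /\ forall j, (j < i)%N -> radius n <= d (q j) y]).
split.
- move=> n i; apply: closedI; first exact: closed_metric_ball.
  rewrite [X in closed X](_ : _ =
      \bigcap_(j in [set j | (j < i)%N]) ~` [set y | d (q j) y < radius n]).
    by apply: closed_bigI => j _; rewrite closedC; exact: open_metric_ball.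
  by apply/seteqP; split=> y h j ji; have := h j ji; rewrite /= leNgt => /negP.
- move=> n y; have := dense_approx y (radius_gt0 n).
  move=> /ex_minnP[i iy imin]; exists i; split; first exact: ltW.
  by move=> j ji; rewrite leNgt; apply/negP => /imin; rewrite leqNgt ji.
- move=> n y; have [b bn] := dense_approx y (radius_gt0 n).
  exists b => i [_ h]; rewrite leqNgt; apply/negP => /h.
  by rewrite leNgt bn.
- move=> u /choice[z zP].
  have dz m j k : (m < j)%N -> (m < k)%N -> d (z j) (z k) <= radius m + radius m.
    move=> mj mk; have [h1 _] := zP j m mj; have [h2 _] := zP k m mk.
    by move: (dtri (z j) (q (u m)) (z k)); rewrite (dsym (z j) (q (u m))); lra.
  have [e e0|l lz] := completed (u := z).
    have e2 : 0 < e / 2 by lra.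
    have [m me] := radius_small e2; exists m.+1 => j k mj mk.
    by have := dz _ _ _ mj mk; lra.
  exists l => j.
  have close i : ~` [set y | d (q i) y < radius j] = [set y | radius j <= d (q i) y].
    by apply/seteqP; split=> y /=; rewrite leNgt => /negP.
  split.
    apply: (closed_cvg [set y | d (q (u j)) y <= radius j] _ _ _ lz).
      exact: closed_metric_ball.
    by exists j.+1 => // k /= jk; have [] := zP k j jk.
  move=> i iu.
  apply: (closed_cvg [set y | radius j <= d (q i) y] _ _ _ lz).
    by rewrite -close closedC; exact: open_metric_ball.
  by exists j.+1 => // k /= jk; have [_] := zP k j jk; apply.
- move=> u y U yP /open_metricP/[apply] -[e e0 eU].
  have e2 : 0 < e / 2 by lra.
  have [m me] := radius_small e2; exists m.+1 => z zP; apply: eU => /=.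
  have [h1 _] := yP m; have [h2 _] := zP m (ltnSn m).
  by move: (dtri y (q (u m)) z); rewrite (dsym y (q (u m))); lra.
Qed.

Lemma metric_baire (U : set X) : open U -> U !=set0 -> ~ meagre U.
Proof.
have [d0 dE dsym dtri] := metricd.
move=> oU [x Ux] [F nF UF].
have [r r0 rU] := iffLR (open_metricP U) oU x Ux.
(* The triple holds the stage, the centre and the radius; the next closed ball lies in the current
   open ball and avoids [F] at this stage. *)
have step (ce : nat * X * R) : exists ce' : X * R, 0 < ce.2 ->
    [/\ 0 < ce'.2, ce'.2 <= radius ce.1.1,
      [set y | d ce'.1 y <= ce'.2] `<=` [set y | d ce.1.2 y < ce.2]
    & [set y | d ce'.1 y <= ce'.2] `&` F ce.1.1 = set0].
  case: ce => -[n c] e /=; have [e0|] := pselect (0 < e); last by exists (c, e).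
  have [V [oV Vc VF]] : exists V, [/\ open V, V !=set0 &
      V `<=` [set y | d c y < e] `\` closure (F n)].
    exists ([set y | d c y < e] `\` closure (F n)); split=> //.
      rewrite setDE; apply: openI; first exact: open_metric_ball.
      by rewrite openC; exact: closed_closure.
    apply: contrapT => h.
    have : (closure (F n))° c.
      apply/topd; exists e => // y /= cy; apply: contrapT => ny.
      by apply: h; exists y.
    by rewrite nF.
  have [c' Vc'] := Vc; have [e' e'0 e'V] := iffLR (open_metricP V) oV c' Vc'.
  have m0 : 0 < Num.min (e' / 2) (radius n).
    by rewrite lt_min radius_gt0 andbT; lra.
  exists (c', Num.min (e' / 2) (radius n)) => _ /=.
  have sub : [set y | d c' y <= Num.min (e' / 2) (radius n)] `<=` V.
    by move=> y /=; rewrite le_min => /andP[h _]; apply: e'V => /=; lra.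
  split=> //.
  - by rewrite ge_min lexx orbT.
  - by move=> y /sub/VF[].
  - by apply/seteqP; split=> // y [/sub/VF[_ ny] /subset_closure].
have /choice[next nextP] := step.
pose s := fix s n := if n is n'.+1 then next (n', (s n').1, (s n').2) else (x, r).
have spos n : 0 < (s n).2.
  by elim: n => //= n IH; have [] := nextP (n, (s n).1, (s n).2) IH.
have sP n := nextP (n, (s n).1, (s n).2) (spos n).
pose B n := [set y | d (s n).1 y <= (s n).2].
have Bmono n m : (n <= m)%N -> B m `<=` B n.
  elim: m => [|m IH]; first by rewrite leqn0 => /eqP->.
  rewrite leq_eqVlt => /orP[/eqP->//|/IH mn]; apply: subset_trans mn.
  by have [_ _ + _] := sP m => h y /h/= /ltW.
have sB n m : (n <= m)%N -> B n (s m).1.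
  by move=> /Bmono; apply; rewrite /B /= metric_refl ltW.
have [e e0|l lz] := completed (u := fun n => (s n).1).
  have e2 : 0 < e / 2 by lra.
  have [m me] := radius_small e2; exists m.+1 => j k mj mk.
  have h : (s m.+1).2 <= radius m by have [] := sP m.
  have hj : d (s m.+1).1 (s j).1 <= (s m.+1).2 := sB _ _ mj.
  have hk : d (s m.+1).1 (s k).1 <= (s m.+1).2 := sB _ _ mk.
  move: (dtri (s j).1 (s m.+1).1 (s k).1); rewrite (dsym (s j).1 (s m.+1).1).
  by lra.
have lB n : B n l.
  apply: (closed_cvg (B n) _ _ _ lz); first exact: closed_metric_ball.
  by exists n => // m /= /sB.
have : U l.
  apply: rU; have [_ _ h _] := sP 0; exact: h (lB 1).
rewrite UF => -[n _ Fl]; have [_ _ _ h] := sP n.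
have lBF : (B n.+1 `&` F n) l by split; [exact: lB|].
by have : set0 l by rewrite -h.
Qed.

End Dense.
End Metric.

(** * Borel enumeration of components *)

Lemma countable_dense_sequence (X : topologicalType) (x0 : X) :
  separable X -> exists q : nat -> X, dense (range q).
Proof.
move=> [D /countable_injP[f injf] dD].
have [x [_ Dx]] : setT `&` D !=set0 by apply: dD => //; [exists x0|exact: openT].
have /choice[q qP] : forall n, exists y, D y /\ forall z, D z -> f z = n -> z = y.
  move=> n; have [[y [Dy fy]]|ny] := pselect (exists y, D y /\ f y = n).
    exists y; split=> // z Dz fz; apply: injf; rewrite ?inE//.
    by rewrite fz.
  by exists x; split=> // z Dz fz; exfalso; apply: ny; exists z.
exists q => W W0 oW; have [y [Wy Dy]] := dD _ W0 oW.
exists y; split=> //; exists (f y) => //.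
by have [_ h] := qP (f y); rewrite -(h y).
Qed.

Lemma polish_structure (R : realType) (X : topologicalType) (x0 : X) :
  polish R X -> exists (P : nat -> nat -> set X) (U K : nat -> set X),
    [/\ closed_scheme P, separated_points X, regular_base U K
      & forall W : set X, open W -> W !=set0 -> ~ meagre W].
Proof.
move=> [/(countable_dense_sequence x0)[q dq] [d [md td cd]]].
have [P sP] := metric_closed_scheme md td dq cd.
have [U [K UK]] := metric_regular_base md td dq.
exists P, U, K; split=> //; first exact: metric_separated md td.
by move=> W; apply: (metric_baire md td cd).
Qed.

Definition borel_map (Y X : topologicalType) (f : Y -> X) :=
  forall W, open W -> borel (f @^-1` W).

Lemma borel_map_comp (X Y Z : topologicalType) (g : Y -> Z) (f : X -> Y) :
  borel_map g -> borel_map f -> borel_map (g \o f).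
Proof.
move=> bg bf W oW; rewrite comp_preimage.
exact: borel_preimage bf (bg W oW).
Qed.

Lemma continuous_borel_map (Y X : topologicalType) (f : Y -> X) :
  continuous f -> borel_map f.
Proof. by move=> /continuousP cf W oW; apply: borel_open; exact: cf. Qed.

Lemma borel_map_id (X : topologicalType) : borel_map (@id X).
Proof. by move=> W; exact: borel_open. Qed.

Section Products.
Variables (X : topologicalType) (U K : nat -> set X).
Hypothesis baseUK : regular_base U K.

Lemma borel_map_snd : borel_map (@snd X X).
Proof. by apply: continuous_borel_map => x; exact: cvg_snd. Qed.

Lemma open_rectangle (A B : set X) : open A -> open B -> open (A `*` B).
Proof.
move=> oA oB; have -> : A `*` B = (fst @^-1` A) `&` (snd @^-1` B) by [].
apply: openI; [move: A oA|move: B oB]; apply/continuousP => x;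
  [exact: cvg_fst|exact: cvg_snd].
Qed.

Lemma closed_rectangle (A B : set X) : closed A -> closed B -> closed (A `*` B).
Proof.
move=> cA cB; have -> : A `*` B = (fst @^-1` A) `&` (snd @^-1` B) by [].
apply: closedI; [move: A cA|move: B cB]; apply/continuous_closedP => x;
  [exact: cvg_fst|exact: cvg_snd].
Qed.

Lemma open_rectangle_cover (W : set (X * X)) x y : open W -> W (x, y) ->
  exists p p', [/\ U p x, U p' y & K p `*` K p' `<=` W].
Proof.
have [_ _ _ bUK] := baseUK.
move=> oW Wxy; have : nbhs (x, y) W by exact: open_nbhs_nbhs.
case=> -[A B] /= [/nbhs_interior/nbhs_singleton Ax /nbhs_interior/nbhs_singleton By] ABW.
have [p [px pA]] := bUK _ _ (@open_interior _ A) Ax.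
have [p' [py pB]] := bUK _ _ (@open_interior _ B) By.
exists p, p'; split=> // -[z z'] [/= /pA/interior_subset Az /pB/interior_subset Bz].
exact: ABW.
Qed.

Lemma borel_rel (Y : topologicalType) (f g : Y -> X) (W : set (X * X)) :
  borel_map f -> borel_map g -> borel W -> borel [set y | W (f y, g y)].
Proof.
have [oU _ UK _] := baseUK.
move=> bf bg; apply: (@borel_preimage _ _ (fun y => (f y, g y))) => {}W oW.
have -> : (fun y => (f y, g y)) @^-1` W = [set y | exists pp : nat * nat,
    (K pp.1 `*` K pp.2 `<=` W) /\ (U pp.1 (f y) /\ U pp.2 (g y))].
  apply/seteqP; split=> y /= => [/(open_rectangle_cover oW)[p [p' [? ? ?]]]|].
    by exists (p, p').
  by move=> [[p p'] /= [sub [Up Up']]]; apply: sub; split; exact: UK.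
apply: borel_exists => -[p p']; apply: borel_and; first exact: borel_cst.
by apply: borel_and; [exact: bf|exact: bg].
Qed.

Lemma bounded_souslin_borel_prod (W : set (X * X)) : borel W -> bounded_souslin W.
Proof.
have [oU cK UK _] := baseUK.
apply: bounded_souslin_borel => {}W oW.
pose V (F : nat -> set X) n := if unpickle n is Some (p, p') then
  if pselect (K p `*` K p' `<=` W) then F p `*` F p' else set0 else set0.
exists (V U), (V K); split.
- move=> n; rewrite /V; case: unpickle => [[p p']|]; last exact: open0.
  by case: pselect => ? /=; [exact: open_rectangle|exact: open0].
- move=> n; rewrite /V; case: unpickle => [[p p']|]; last exact: closed0.
  by case: pselect => ? /=; [exact: closed_rectangle|exact: closed0].
- move=> n; rewrite /V; case: unpickle => [[p p']|]; last exact: subset_refl.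
  case: pselect => /= ?; last exact: subset_refl.
  by move=> xy [Ux Uy]; split; exact: UK.
- move=> n; rewrite /V; case: unpickle => [[p p']|]; last exact: sub0set.
  by case: pselect => /= ?; last exact: sub0set.
- move=> [x y] /(open_rectangle_cover oW)[p [p' [Up Up' sub]]].
  exists (pickle (p, p')) => //; rewrite /V pickleK.
  by case: pselect.
Qed.

Variable P : nat -> nat -> set X.
Hypotheses (schemeP : closed_scheme P) (sepX : separated_points X).
Variable G : set (X * X).
Hypotheses (borelG : borel G) (lfG : locally_finite G).

(** This is the projection theorem for finite sections, applied to the edges that end in [A]. *)
Lemma borel_neighbor (A : set X) : borel A ->
  borel [set x | exists y, G (x, y) /\ A y].
Proof.
move=> bA; apply: (bounded_souslin_is_borel schemeP sepX).
apply: (bounded_souslin_project schemeP (B := [set xy | G xy /\ A xy.2])) => [|x].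
  apply: bounded_souslin_borel_prod; apply: borel_and => //.
  exact: (borel_preimage borel_map_snd).
by apply: sub_finite_set (lfG x) => y [].
Qed.

Lemma disjoint_base x y : x <> y -> exists p q, [/\ U p x, U q y & U p `&` U q = set0].
Proof.
have [_ _ UK bUK] := baseUK.
move=> /sepX[V [W [oV oW Vx Wy VW]]].
have [p [px pV]] := bUK _ _ oV Vx; have [q [qy qW]] := bUK _ _ oW Wy.
exists p, q; split=> //; apply/seteqP; split=> // z [/UK/pV Vz /UK/qW Wz].
by rewrite -VW.
Qed.

Lemma separate_finite (F : set X) x : finite_set F -> ~ F x ->
  exists p, U p x /\ forall y, F y -> ~ U p y.
Proof.
have [oU _ UK bUK] := baseUK.
move=> fF nFx.
have cF : closed F.
  suff h : forall y : X, closed [set y].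
    have /finite_seqP[s ->] := fF; elim: s => [|y s IH].
      by rewrite set_nil; exact: closed0.
    have -> : [set` y :: s] = [set y] `|` [set` s].
      by apply/seteqP; split=> z /=; rewrite inE => /predU1P.
    exact: closedU.
  move=> y; rewrite -openC openE => z /= /sepX[V [W [oV oW Vz Wy VW]]].
  apply: filterS (open_nbhs_nbhs (conj oV Vz)) => w Vw wy; have : (V `&` W) w by rewrite wy in Vw *.
  by rewrite VW.
have [p [px pF]] := bUK x (~` F) (closed_openC cF) nFx.
by exists p; split=> // y Fy /UK/pF.
Qed.

(** [g p] moves [x] to its neighbour in [U p] if there is exactly one, and fixes [x] otherwise. By
    local finiteness every neighbour is isolated among the neighbours by some [U p]. *)
Lemma borel_neighbor_functions : exists g : nat -> X -> X,
  [/\ forall p, borel_map (g p), forall p x, g p x = x \/ G (x, g p x)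
    & forall x y, G (x, y) -> exists p, g p x = y].
Proof.
have [oU _ UK bUK] := baseUK.
pose uniq p x y := [/\ G (x, y), U p y & forall z, G (x, z) -> U p z -> z = y].
have /choice[g0 g0P] : forall px : nat * X, exists y,
    uniq px.1 px.2 y \/ ~ (exists z, uniq px.1 px.2 z) /\ y = px.2.
  move=> [p x]; have [[y py]|ny] := pselect (exists y, uniq p x y).
    by exists y; left.
  by exists x; right.
pose g p x := g0 (p, x).
have gP p x : uniq p x (g p x) \/ ~ (exists z, uniq p x z) /\ g p x = x := g0P (p, x).
have bN A : borel A -> borel [set x | exists y, G (x, y) /\ A y] := @borel_neighbor A.
have bU p : borel (U p) by exact: borel_open.
(* Uniqueness fails exactly when two disjoint basic open sets both contain neighbours lying in
   [U p]; this is a countable condition on neighbour sets. *)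
have buniq p : borel [set x | exists y, uniq p x y].
  have -> : [set x | exists y, uniq p x y] = [set x | (exists y, G (x, y) /\ U p y) /\
      ~ exists ab : nat * nat, (U ab.1 `&` U ab.2 = set0) /\
        ((exists y, G (x, y) /\ (U p y /\ U ab.1 y)) /\
         (exists y, G (x, y) /\ (U p y /\ U ab.2 y)))].
    apply/seteqP; split=> x /=.
      move=> [y [Gy Uy uy]]; split; first by exists y.
      move=> [[a b] /= [ab [[z [Gz [Uz az]]] [w [Gw [Uw bw]]]]]].
      have : (U a `&` U b) y.
        by split; [rewrite -(uy z Gz Uz)|rewrite -(uy w Gw Uw)].
      by rewrite ab.
    move=> [[y [Gy Uy]] h]; exists y; split=> // z Gz Uz; apply: contrapT.
    move=> /disjoint_base[a [b [az bz ab]]]; apply: h; exists (a, b).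
    by split=> //; split; [exists z|exists y].
  apply: borel_and; first exact: bN.
  apply: borel_not; apply: borel_exists => -[a b].
  apply: borel_and; first exact: borel_cst.
  by apply: borel_and; apply: bN; apply: borel_and; exact: bU.
exists g; split.
- move=> p W oW.
  have -> : g p @^-1` W = [set x | ((exists y, uniq p x y) /\
      exists y, G (x, y) /\ (U p y /\ W y)) \/ (~ (exists y, uniq p x y) /\ W x)].
    apply/seteqP; split=> x /=.
      have [u Wg|[nu ->] Wx] := gP p x; last by right.
      left; split; first by exists (g p x).
      by case: u => Gx Ux _; exists (g p x).
    have [u|[nu ->]] := gP p x; last by case=> -[].
    have [_ _ ux] := u.
    case=> [[_ [y [Gy [Uy Wy]]]]|[nu _]]; first by rewrite -(ux y).
    by exfalso; apply: nu; exists (g p x).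
  apply: borel_or; apply: borel_and => //.
  + by apply: bN; apply: borel_and; [exact: bU|exact: borel_open].
  + exact: borel_not.
  + exact: borel_open.
- by move=> p x; have [[Gx _ _]|[_ ->]] := gP p x; [right|left].
- move=> x y Gxy.
  have [p [py pF]] : exists p, U p y /\ forall z, (G (x, z) /\ z <> y) -> ~ U p z.
    apply: separate_finite; last by case.
    by apply: sub_finite_set (lfG x) => z [].
  have u : uniq p x y.
    by split=> // z Gz pz; apply: contrapT => zy; apply: (pF z).
  exists p; have [[Gg Ug _]|[nu _]] := gP p x; last by exfalso; apply: nu; exists y.
  by have [_ _] := u; apply.
Qed.

(** The functions are the finite compositions of neighbour functions, indexed by their words. *)
Lemma component_enumeration : exists phi : nat -> X -> X,
  (forall i, borel_map (phi i)) /\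
  forall x y, joined G x y <-> exists i, phi i x = y.
Proof.
have [g [bg gG Gg]] := borel_neighbor_functions.
pose f s x := foldr g x s.
exists (fun i => if unpickle i is Some s then f s else id); split.
  move=> i; case: unpickle => [s|]; last exact: borel_map_id.
  elim: s => [|p s IH]; first exact: borel_map_id.
  exact: (@borel_map_comp _ _ _ (g p) (f s)).
move=> x y.
have -> : (exists i, (if unpickle i is Some s then f s else id) x = y) <->
    exists s, f s x = y.
  split=> [[i]|[s <-]]; last by exists (pickle s); rewrite pickleK.
  by case: unpickle => [s|] <-; [exists s|exists [::]].
split=> [|[s <-]].
  elim=> {x y} [x y /Gg[p gp]|x|x y z _ [s sy] _ [t tz]].
  - by exists [:: p].
  - by exists [::].
  - by exists (t ++ s); rewrite /f foldr_cat -/(f s x) sy.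
elim: s => [|p s IH] /=; first exact: rt_refl.
have [->//|Gs] := gG p (f s x).
by apply: rt_trans IH _; exact: rt_step.
Qed.

End Products.

(** * Connected sets of vertices and balls *)

Section Joined.
Variables (X : Type) (E : set (X * X)).

Lemma joined_refl x : joined E x x.
Proof. exact: rt_refl. Qed.

Lemma joined_step x y : E (x, y) -> joined E x y.
Proof. exact: rt_step. Qed.

Lemma joined_trans y x z : joined E x y -> joined E y z -> joined E x z.
Proof. exact: rt_trans. Qed.

Lemma joined_sub (E' : set (X * X)) x y : E `<=` E' -> joined E x y -> joined E' x y.
Proof.
move=> EE'; elim=> {x y} [x y /EE'|x|x y z _ xy _ yz].
- exact: rt_step.
- exact: rt_refl.
- exact: rt_trans yz.
Qed.

Lemma joined_sym x y : (forall x y, E (x, y) -> E (y, x)) ->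
  joined E x y -> joined E y x.
Proof.
move=> symE; elim=> {x y} [x y /symE|x|x y z _ xy _ yz].
- exact: rt_step.
- exact: rt_refl.
- exact: rt_trans xy.
Qed.

Lemma joined_ind (S : X -> Prop) x y :
  S x -> (forall y z, S y -> E (y, z) -> S z) -> joined E x y -> S y.
Proof.
move=> + SE j; elim: j => {x y} [x y Exy Sx|//|x y z _ IH1 _ IH2 Sx].
  exact: SE Sx Exy.
exact: IH2 (IH1 Sx).
Qed.

End Joined.

Section Graph.
Variables (X : choiceType) (G : set (X * X)).
Hypothesis symG : forall x y, G (x, y) -> G (y, x).
Hypothesis lfG : locally_finite G.
Implicit Types (K L Q V W : set X).

Definition conn K := graph_connected K G.

Lemma induced_sym V x y : induced G V (x, y) -> induced G V (y, x).
Proof. by move=> [/symG ? [? ?]]. Qed.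

Lemma induced_sub V W : V `<=` W -> induced G V `<=` induced G W.
Proof. by move=> VW [x y] [? [/VW ? /VW ?]]. Qed.

Lemma joined_induced_sym V x y :
  joined (induced G V) x y -> joined (induced G V) y x.
Proof. by apply: joined_sym; exact: induced_sym. Qed.

Lemma joined_induced_sub V W x y : V `<=` W ->
  joined (induced G V) x y -> joined (induced G W) x y.
Proof. by move=> VW; apply: joined_sub; exact: induced_sub. Qed.

Lemma joined_induced_joined V x y : joined (induced G V) x y -> joined G x y.
Proof. by apply: joined_sub => e []. Qed.

Lemma joined_induced_mem V x y : joined (induced G V) x y -> V x -> V y.
Proof. by move=> j Vx; apply: (joined_ind Vx _ j) => y' z _ [_ []]. Qed.

(** [A] serves as a hub: every point reaches it inside [B] through a connected piece that meets or
    touches [A]. *)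
Lemma conn_star_adj (A B : set X) : conn A -> A `<=` B ->
  (forall y, B y -> exists2 C, conn C /\ C `<=` B &
     C y /\ exists z a, [/\ C z, A a & z = a \/ G (z, a)]) -> conn B.
Proof.
move=> cA AB h.
have toA y : B y -> exists2 a, A a & joined (induced G B) y a.
  move=> /h[C [cC CB] [Cy [z [a [Cz Aa za]]]]]; exists a => //.
  apply: joined_trans (joined_induced_sub CB (cC _ _ Cy Cz)) _.
  case: za => [->|za]; first exact: joined_refl.
  by apply: joined_step; split=> //; split; [exact: CB|exact: AB].
move=> x y /toA[x' Ax' xx'] /toA[y' Ay' yy'].
apply: joined_trans xx' _; apply: joined_trans (joined_induced_sym yy').
exact: joined_induced_sub AB (cA _ _ Ax' Ay').
Qed.

Lemma conn_star (A B : set X) : conn A -> A `<=` B ->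
  (forall y, B y -> exists2 C, conn C /\ C `<=` B & C y /\ C `&` A !=set0) -> conn B.
Proof.
move=> cA AB h; apply: (conn_star_adj cA AB) => y /h[C CB [Cy [z [Cz Az]]]].
by exists C => //; split=> //; exists z, z; split=> //; left.
Qed.

Lemma conn_joined K x y : conn K -> K x -> K y -> joined G x y.
Proof. by move=> cK Kx Ky; apply: joined_induced_joined (cK _ _ Kx Ky). Qed.

Lemma conn_set1 x : conn [set x].
Proof. by move=> _ _ -> ->; exact: joined_refl. Qed.

Fixpoint gball k x : set X :=
  if k is k'.+1 then [set y | gball k' x y \/ exists2 z, gball k' x z & G (z, y)]
  else [set x].

Definition nball k K : set X := \bigcup_(x in K) gball k x.

Lemma gball_refl k x : gball k x x.
Proof. by elim: k => //= k IH; left. Qed.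

Lemma gball_mono k l x : k <= l -> gball k x `<=` gball l x.
Proof.
elim: l => [|l IH]; first by rewrite leqn0 => /eqP->.
by rewrite leq_eqVlt => /orP[/eqP->//|/IH kl] y /kl; left.
Qed.

Lemma gball_trans k l x y z : gball k x y -> gball l y z -> gball (k + l) x z.
Proof.
move=> xy; elim: l z => [z ->|l IH z]; first by rewrite addn0.
by rewrite addnS => -[/IH|[w /IH xw wz]]; [left|right; exists w].
Qed.

Lemma gball_sym k x y : gball k x y -> gball k y x.
Proof.
elim: k x y => [x y ->//|k IH x y [/IH|[z /IH zx zy]]]; first by left.
have yz : gball 1 y z by right; exists y => //; exact: symG.
by rewrite -add1n; exact: gball_trans yz zx.
Qed.

Lemma gball_joined_gball k x y : gball k x y -> joined (induced G (gball k x)) x y.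
Proof.
elim: k y => [y ->|k IH y]; first exact: joined_refl.
have kS : gball k x `<=` gball k.+1 x by exact: gball_mono.
case=> [/IH|[z xz zy]]; first exact: joined_induced_sub.
apply: joined_trans (joined_induced_sub kS (IH _ xz)) _.
by apply: joined_step; split=> //; split=> /=; [left|right; exists z].
Qed.

Lemma gball_joined k x y : gball k x y -> joined G x y.
Proof. by move=> /gball_joined_gball; exact: joined_induced_joined. Qed.

Lemma joined_gball x y : joined G x y -> exists k, gball k x y.
Proof.
elim=> {x y} [x y xy|x|x y z _ [k xy] _ [l yz]].
- by exists 1; right; exists x.
- by exists 0.
- by exists (k + l); exact: gball_trans xy yz.
Qed.

Lemma gball_finite k x : finite_set (gball k x).
Proof.
elim: k => [|k IH]; first exact: finite_set1.
have -> : gball k.+1 x = gball k x `|` \bigcup_(z in gball k x) [set y | G (z, y)].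
  apply/seteqP; split=> y [|[z]]; [by left|by right; exists z|by left|].
  by right; exists z.
by rewrite finite_setU; split=> //; apply: bigcup_finite => // z _; exact: lfG.
Qed.

Lemma gball_conn k x : conn (gball k x).
Proof.
move=> y z /gball_joined_gball xy /gball_joined_gball xz.
exact: joined_trans (joined_induced_sym xy) xz.
Qed.

Lemma nball_finite k K : finite_set K -> finite_set (nball k K).
Proof. by move=> fK; apply: bigcup_finite => // x _; exact: gball_finite. Qed.

Lemma sub_nball k K : K `<=` nball k K.
Proof. by move=> x Kx; exists x => //; exact: gball_refl. Qed.

Lemma nball_mono k l K : k <= l -> nball k K `<=` nball l K.
Proof. by move=> kl y [x Kx xy]; exists x => //; exact: gball_mono xy. Qed.

Lemma nball_conn k K : conn K -> conn (nball k K).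
Proof.
move=> cK; apply: (conn_star cK (@sub_nball k K)) => y [x Kx xy].
exists (gball k x); split=> //; first exact: gball_conn.
  by move=> z xz; exists x.
by exists x; split=> //; exact: gball_refl.
Qed.

Lemma nball1P K y : nball 1 K y <-> K y \/ exists2 x, K x & G (x, y).
Proof.
split=> [[x Kx [->|[z -> xy]]]|[Ky|[x Kx xy]]]; [by left|by right; exists x| |].
  by exists y => //; left.
by exists x => //; right; exists x.
Qed.

Lemma nball1_adj K x y : K x -> G (x, y) -> nball 1 K y.
Proof. by move=> Kx xy; apply/nball1P; right; exists x. Qed.

End Graph.

(** * Partial toasts *)

Section States.
Variables (X : choiceType) (G : set (X * X)).
Hypothesis symG : forall x y, G (x, y) -> G (y, x).
Hypothesis lfG : locally_finite G.
Implicit Types (K L Q V W : set X) (H : set (nat * set X)).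

Local Notation conn := (conn G).
Local Notation nball := (nball G).
Local Notation gball := (gball G).

(* A partial toast [H] consists of pairs [(k, L)], where [L] is a member of the
   toast and [nball k L] is a protected zone: every later member has to contain
   it or to avoid it. *)
Definition covered H : set X := \bigcup_(kL in H) kL.2.

Definition members H : set (set X) := [set L | exists k, H (k, L)].

Definition compatible H K := forall k L, H (k, L) ->
  nball k L `<=` K \/ nball k L `&` K = set0.

Definition proper_cover (T : set (set X)) K : set X :=
  \bigcup_(L in [set L | T L /\ L `<` K]) L.

(** The invariant of the construction. The second clause is (T2) and the last is (T3); the third
    allows paths to be rerouted inside zones, and the fourth provides the hulls from which further
    members are built. *)
Definition good_state H :=
  [/\ forall k L, H (k, L) -> [/\ 0 < k, L !=set0, finite_set L & conn L],
      forall K L, members H K -> members H L -> K <> L ->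
        [\/ nball 1 K `&` L = set0, nball 1 K `<=` L | nball 1 L `<=` K],
      forall k L a b, H (k, L) -> (nball 1 L `\` covered H) a ->
        (nball 1 L `\` covered H) b ->
        joined (induced G (nball k L `\` covered H)) a b,
      forall v, exists Q, [/\ finite_set Q, conn Q, compatible H Q & Q v]
    & forall K, members H K -> conn (K `\` proper_cover (members H) K)].

Lemma good_state0 : good_state set0.
Proof.
split=> //; first by move=> K L [].
  move=> v; exists [set v]; split=> //; exact: conn_set1.
by move=> K [].
Qed.

(* A path in [Q] is rerouted around each member [L] it meets, through the
   protected zone of [L]. *)
Lemma conn_setD_covered H Q : good_state H -> compatible H Q -> conn Q ->
  conn (Q `\` covered H).
Proof.
move=> [i0 i1 i2 _ _] cQ conQ x y [Qx Ux] [Qy Uy].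
pose J := joined (induced G (Q `\` covered H)) x.
(* The invariant along a path in [Q]: an uncovered vertex is reached off the members, and at a
   vertex inside a member all uncovered boundary points of that member are reached. *)
pose S v := Q v /\ ((~ covered H v -> J v) /\
  forall k L a, H (k, L) -> L v -> (nball 1 L `\` covered H) a -> J a).
have covm k L v : H (k, L) -> L v -> covered H v by move=> HL Lv; exists (k, L).
suff : S y by case=> _ [+ _]; apply.
apply: (joined_ind _ _ (conQ _ _ Qx Qy)).
  split=> //; split=> [_|k L a HL Lx]; first exact: joined_refl.
  by have := Ux (covm _ _ _ HL Lx).
move=> v w [Qv [Sv1 Sv2]] [Gvw [_ Qw]].
have [Uv|nUv] := pselect (covered H v).
  have [[k L] /= HL Lv] := Uv.
  have wL : nball 1 L w by exact: nball1_adj Lv Gvw.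
  split=> //; split=> [nUw|k' L' a HL' L'w L'a]; first exact: (Sv2 k L).
  (* When the path passes from [L] into a member [L'] not containing [v], (T2) leaves only [L'] with
     its boundary inside [L]; then [L'] has no uncovered boundary point. *)
  have [L'v|nL'v] := pselect (L' v); first exact: (Sv2 k' L').
  have mL : members H L by exists k.
  have mL' : members H L' by exists k'.
  have LL' : L <> L' by move=> e; apply: nL'v; rewrite -e.
  have [] := i1 _ _ mL mL' LL'.
  - by move=> e; have : (nball 1 L `&` L') w by []; rewrite e.
  - by move=> sub; exfalso; apply: nL'v; apply: sub; exact: sub_nball.
  - move=> sub; case: L'a => /sub La nUa; exfalso; apply: nUa; exact: covm HL La.
have Jv := Sv1 nUv.
split=> //; split=> [nUw|k L a HL Lw La].
  by apply: joined_trans Jv _; apply: joined_step.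
apply: joined_trans Jv _.
have [k0 _ _ _] := i0 _ _ HL.
have vL : nball 1 L v by apply: nball1_adj Lw (symG Gvw).
apply: joined_induced_sub (i2 _ _ _ _ HL (conj vL nUv) La) => z [Lz nUz].
split=> //; have [|e] := cQ _ _ HL; first exact.
have : (nball k L `&` Q) w by split=> //; exact: sub_nball.
by rewrite e.
Qed.

(** A member containing [a] has a zone that meets [K], hence lies in [K]; but [a] is outside [K]. *)
Lemma boundary_uncovered H K a : good_state H -> compatible H K ->
  (nball 1 K `\` K) a -> ~ covered H a.
Proof.
move=> [i0 _ _ _ _] cK [/nball1P[//|[x Kx xa]] nKa] [[l L] /= HL La].
have [l0 _ _ _] := i0 _ _ HL.
have [sub|e] := cK _ _ HL; first by apply: nKa; apply: sub; exact: sub_nball.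
have : (nball l L `&` K) x.
  by split=> //; apply: (nball_mono l0); apply: nball1_adj La (symG xa).
by rewrite e.
Qed.

(** [K] is an isolated cluster of [W] at scale [r], so it is determined by [W] and any one of its
    points. *)
Definition far_in (r : nat) W K :=
  [/\ K `<=` W, forall a b, K a -> K b -> gball r a b
    & forall a b, K a -> gball r a b -> W b -> K b].

Lemma far_inP r W K K' a a' : far_in r W K -> far_in r W K' -> K a -> K' a' ->
  gball r a a' -> K = K'.
Proof.
move=> [KW dK sK] [K'W dK' sK'] Ka K'a' aa'.
have Ka' : K a' by apply: sK aa' _ => //; exact: K'W.
apply/seteqP; split=> b Kb.
  by apply: sK' K'a' _ _; [exact: dK|exact: KW].
by apply: sK Ka' _ _; [exact: dK'|exact: K'W].
Qed.

(** Isolation at scale [r + r] keeps the [r]-balls around distinct candidates disjoint. The set [Q]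
    is a hull of the zone inside such a ball, so all candidates can be added simultaneously. *)
Definition candidate H (k r : nat) W K :=
  [/\ [/\ K !=set0, finite_set K & conn K],
      far_in (r + r) W K,
      exists Q, [/\ finite_set Q, conn Q, compatible H Q, nball k K `<=` Q & Q `<=` nball r K],
      compatible H K
    & forall a b, (nball 1 K `\` K) a -> (nball 1 K `\` K) b ->
        joined (induced G (nball k K `\` (K `|` covered H))) a b].

Definition extend H k r W : set (nat * set X) :=
  H `|` [set lK | lK.1 = k /\ candidate H k r W lK.2].

(** A candidate inside an old member meets its zone, so by compatibility contains it and equals that
    member. Hence the part removed from an old member in (T3) never changes. *)
Lemma extend_no_submember H k r W K L : good_state H -> members H K ->
  members (extend H k r W) L -> L `<=` K -> members H L.
Proof.
move=> [i0 _ _ _ _] [kK HK] [l [HL _|[_ /= [[L0 _ _] _ _ cL _]] LK]]; first by exists l.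
have [_ K0 _ _] := i0 _ _ HK.
have KL : K `<=` L.
  have [sub|e] := cL _ _ HK; first by move=> z Kz; apply: sub; exact: sub_nball.
  have [z Lz] := L0; have : (nball kK K `&` L) z by split=> //; apply: sub_nball; exact: LK.
  by rewrite e.
have -> : L = K by apply/seteqP.
by exists kK.
Qed.

Hypothesis infG : forall x, infinite_set [set y | joined G x y].

Lemma boundary_nonempty K : finite_set K -> K !=set0 -> (nball 1 K `\` K) !=set0.
Proof.
move=> fK [x Kx]; apply: contrapT => h; apply: (@infG x).
apply: sub_finite_set fK => y; apply: joined_ind => // z w Kz zw.
apply: contrapT => nKw; apply: h; exists w; split=> //.
exact: nball1_adj Kz zw.
Qed.

(** * Adding all candidates at one stage *)

Section Extension.
Variables (H : set (nat * set X)) (k r : nat) (W : set X).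
Hypotheses (gH : good_state H) (k_gt0 : 0 < k).
Local Notation H' := (extend H k r W).
Local Notation cand := (candidate H k r W).

Let nball1k j L : 0 < j -> nball 1 L `<=` nball j L.
Proof. exact: nball_mono. Qed.

Lemma candidate_sep K K' a : cand K -> cand K' -> nball r K a -> nball r K' a -> K = K'.
Proof.
move=> [_ fK _ _ _] [_ fK' _ _ _] [x Kx xa] [x' K'x' x'a].
apply: (far_inP fK fK' Kx K'x').
exact: gball_trans xa (gball_sym symG x'a).
Qed.

Lemma candidate_ball K : cand K -> nball k K `<=` nball r K.
Proof. by move=> [_ _ [Q [_ _ _ KQ Qr]] _ _]; exact: subset_trans KQ Qr. Qed.

Lemma candidate_disj K K' : cand K -> cand K' -> K <> K' -> nball k K `&` K' = set0.
Proof.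
move=> cK cK' nKK'; apply/seteqP; split=> // a [/(candidate_ball cK) Ka K'a].
by apply: nKK'; apply: (candidate_sep cK cK' Ka); exact: sub_nball.
Qed.

Lemma candidate_not_member K L : cand K -> members H L -> K `<=` L -> False.
Proof.
have [i0 _ _ _ _] := gH.
move=> [[[x Kx] _ _] _ _ cK _] [l HL] KL; have [l0 L0 fL cL] := i0 _ _ HL.
have [sub|e] := cK _ _ HL; last first.
  by have : (nball l L `&` K) x; [split=> //; apply: sub_nball; exact: KL|rewrite e].
have [y [Ly nLy]] := boundary_nonempty fL L0.
by apply: nLy; apply: KL; apply: sub; exact: nball1k.
Qed.

Lemma covered_extend a : covered H' a <-> covered H a \/ exists2 K, cand K & K a.
Proof.
split=> [[[l L] /= [HL|[_ /= cL]] La]|[[[l L] HL La]|[K cK Ka]]].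
- by left; exists (l, L).
- by right; exists L.
- by exists (l, L) => //; left.
- by exists (k, K) => //; right.
Qed.

Lemma members_extend L : members H' L <-> members H L \/ cand L.
Proof.
split=> [[l [HL|[_ /= cL]]]|[[l HL]|cL]].
- by left; exists l.
- by right.
- by exists l; left.
- by exists k; right.
Qed.

Lemma extend_toast K L : members H' K -> members H' L -> K <> L ->
  [\/ nball 1 K `&` L = set0, nball 1 K `<=` L | nball 1 L `<=` K].
Proof.
have [i0 i1 _ _ _] := gH.
have mix K' L' : members H K' -> cand L' ->
    nball 1 K' `<=` L' \/ nball 1 K' `&` L' = set0.
  move=> [l HK] [_ _ _ cL _]; have [l0 _ _ _] := i0 _ _ HK.
  have [sub|e] := cL _ _ HK; [left|right].
    exact: subset_trans (nball1k l0) sub.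
  apply/seteqP; split=> // z [Kz Lz]; rewrite -e; split=> //.
  exact: nball1k.
have adj_sym A B : nball 1 A `&` B = set0 -> nball 1 B `&` A = set0.
  move=> e; apply/seteqP; split=> // z [/nball1P[Bz|[x Bx xz]] Az].
    by rewrite -e; split=> //; exact: sub_nball.
  suff : (nball 1 A `&` B) x by rewrite e.
  by split=> //; apply: nball1_adj Az (symG xz).
move=> /members_extend[mK|cK] /members_extend[mL|cL] KL.
- exact: i1.
- by have [?|?] := mix _ _ mK cL; [apply: Or32|apply: Or31].
- by have [?|/adj_sym ?] := mix _ _ mL cK; [apply: Or33|apply: Or31].
- apply: Or31; apply/seteqP; split=> // z [Kz Lz].
  by rewrite -(candidate_disj cK cL KL); split=> //; exact: nball1k.
Qed.

(** If [L] is old, [a] is an uncovered point of its zone, so no candidate contains the zone; all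
    candidates avoid it and the old path survives. If [L] is new, its zone avoids the other
    candidates. *)
Lemma extend_reroute l L a b : H' (l, L) -> (nball 1 L `\` covered H') a ->
  (nball 1 L `\` covered H') b -> joined (induced G (nball l L `\` covered H')) a b.
Proof.
have [i0 _ i2 _ _] := gH.
move=> [HL|[/= -> cL]] [La nUa] [Lb nUb]; last first.
  have nKK z : ~ covered H' z -> ~ L z.
    by move=> nz Lz; apply: nz; apply/covered_extend; right; exists L.
  have [_ _ _ _ h] := cL.
  apply: joined_induced_sub (h _ _ (conj La (nKK _ nUa)) (conj Lb (nKK _ nUb))).
  move=> z [Lz nz]; split=> // /covered_extend[Uz|[K cK Kz]]; apply: nz; first by right.
  have [->|KL] := pselect (L = K); first by left.
  suff : (nball k L `&` K) z by rewrite (candidate_disj cL cK KL).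
  by [].
have [l0 _ _ _] := i0 _ _ HL.
have disj K : cand K -> nball l L `&` K = set0.
  move=> cK; have [_ _ _ cKH _] := cK.
  have [sub|//] := cKH _ _ HL; exfalso; apply: nUa.
  by apply/covered_extend; right; exists K => //; apply: sub; exact: nball1k.
have nU z : ~ covered H' z -> ~ covered H z.
  by move=> nz Uz; apply: nz; apply/covered_extend; left.
apply: joined_induced_sub (i2 _ _ _ _ HL (conj La (nU _ nUa)) (conj Lb (nU _ nUb))).
move=> z [Lz nz]; split=> // /covered_extend[//|[K cK Kz]].
by have : (nball l L `&` K) z by []; rewrite disj.
Qed.

(** To an old hull [Q0] of [v] add the hulls [Q K] of candidates that meet it. Hulls of distinct
    candidates are disjoint, so the added parts meet no further hull and one round suffices. *)
Lemma extend_compatible v : exists Q, [/\ finite_set Q, conn Q, compatible H' Q & Q v].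
Proof.
have [_ _ _ i3 _] := gH.
have [Q0 [fQ0 cQ0 cHQ0 Q0v]] := i3 v.
have /choice[Q QP] : forall K, exists Q, cand K ->
    [/\ finite_set Q, conn Q, compatible H Q, nball k K `<=` Q & Q `<=` nball r K].
  move=> K; have [cK|] := pselect (cand K); last by exists set0.
  by have [_ _ [Q QP] _ _] := cK; exists Q.
pose F w := \bigcup_(K in [set K | cand K /\ Q K w]) Q K.
exists (Q0 `|` \bigcup_(w in Q0) F w); split.
- rewrite finite_setU; split=> //; apply: bigcup_finite => // w _.
  apply: bigcup_finite; last by move=> K [/QP[]].
  have [[K [cK Kw]]|nK] := pselect (exists K, cand K /\ Q K w).
    apply: (@sub_finite_set _ _ [set K]); last exact: finite_set1.
    move=> K' [cK' K'w]; apply/esym/(candidate_sep (a := w) cK cK').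
      by have [_ _ _ _] := QP _ cK; apply.
    by have [_ _ _ _] := QP _ cK'; apply.
  apply: (@sub_finite_set _ _ set0); last exact: finite_set0.
  by move=> K cK; apply: nK; exists K.
- apply: (conn_star symG cQ0); first by move=> z; left.
  move=> y [Q0y|[w Q0w [K [cK Kw] Ky]]].
    exists Q0; first by split=> // z; left.
    by split=> //; exists y.
  have [_ cQ _ _ _] := QP _ cK.
  exists (Q K); last by split=> //; exists w.
  by split=> // z Kz; right; exists w => //; exists K.
- have sub K w : cand K -> Q0 w -> Q K w -> Q K `<=` Q0 `|` \bigcup_(w in Q0) F w.
    by move=> cK Q0w Kw z Kz; right; exists w => //; exists K.
  move=> l L [HL|[/= -> cL]].
    have [[w [Lw [Q0w|[u Q0u [K [cK Ku] Kw]]]]]|h] :=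
        pselect ((nball l L `&` (Q0 `|` \bigcup_(w in Q0) F w)) !=set0).
    + left; have [s|e] := cHQ0 _ _ HL; first by move=> z /s; left.
      by have : (nball l L `&` Q0) w by []; rewrite e.
    + left; have [_ _ cHK _ _] := QP _ cK.
      have [s|e] := cHK _ _ HL; first exact: subset_trans s (sub _ _ cK Q0u Ku).
      by have : (nball l L `&` Q K) w by []; rewrite e.
    + by right; apply: contrapT => /eqP/set0P.
  have [_ _ _ LQ _] := QP _ cL.
  have [[w [Lw [Q0w|[u Q0u [K [cK Ku] Kw]]]]]|h] :=
      pselect ((nball k L `&` (Q0 `|` \bigcup_(w in Q0) F w)) !=set0).
  + by left; apply: (subset_trans LQ); apply: (sub _ w) => //; exact: LQ.
  + left; have KL : K = L.
      have [_ _ _ _ QK] := QP _ cK.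
      by apply: (candidate_sep (a := w) cK cL); [exact: QK|exact: candidate_ball].
    by apply: (subset_trans LQ); apply: (sub _ u) => //; rewrite -KL.
  + by right; apply: contrapT => /eqP/set0P.
- by left.
Qed.

(** For a new [K] the members properly inside it are exactly the old members meeting it, so
    rerouting in [K] applies. *)
Lemma extend_conn K : members H' K -> conn (K `\` proper_cover (members H') K).
Proof.
have [i0 _ _ _ i4] := gH.
move=> /members_extend[mK|cK].
  have -> : proper_cover (members H') K = proper_cover (members H) K; last exact: i4.
  apply/seteqP; split=> z [L [mL LK] Lz]; exists L => //; split=> //.
    by apply: extend_no_submember gH mK mL _; exact: properW.
  by apply/members_extend; left.
have [[_ _ conK] _ _ cHK _] := cK.
have -> : K `\` proper_cover (members H') K = K `\` covered H.
  apply/seteqP; split=> z [Kz nz]; split=> //.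
    move=> [[l L] /= HL Lz]; apply: nz; exists L => //; split.
      by apply/members_extend; left; exists l.
    split; last by move=> KL; apply: (@candidate_not_member K L) => //; exists l.
    have [sub|e] := cHK _ _ HL; first by move=> w Lw; apply: sub; exact: sub_nball.
    have : (nball l L `&` K) z by split=> //; exact: sub_nball.
    by rewrite e.
  move=> [L [/members_extend[[l HL]|cL] LK] Lz]; first by apply: nz; exists (l, L).
  case: LK => LK; apply.
  have <- // : K = L.
  by apply: (candidate_sep (a := z) cK cL); exact: sub_nball.
exact: conn_setD_covered.
Qed.

Lemma good_state_extend : good_state H'.
Proof.
have [i0 _ _ _ _] := gH.
split; [|exact: extend_toast|exact: extend_reroute|exact: extend_compatible|exact: extend_conn].
by move=> l L [/i0//|[/= -> [[L0 fL cL] _ _ _ _]]].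
Qed.

End Extension.

End States.

(** * Admissible members *)

Lemma finite_set_bound (T : eqType) (A : set T) (S : T -> nat -> Prop) :
  finite_set A -> (forall a m n, m <= n -> S a m -> S a n) ->
  (forall a, A a -> exists n, S a n) -> exists n, forall a, A a -> S a n.
Proof.
move=> /finite_seqP[s ->] monoS; elim: s => [|a s IH] h; first by exists 0.
have [|n nP] := IH; first by move=> b bs; apply: h; rewrite /= inE bs orbT.
have [|m mP] := h a; first by rewrite /= mem_head.
exists (maxn m n) => b; rewrite /= inE => /predU1P[->|bs].
  exact: monoS (leq_maxl m n) mP.
exact: monoS (leq_maxr m n) (nP _ bs).
Qed.

Section Existence.
Variables (X : choiceType) (G : set (X * X)).
Hypothesis symG : forall x y, G (x, y) -> G (y, x).
Hypothesis lfG : locally_finite G.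
Hypothesis oeG : one_ended setT G.
Implicit Types (K L Q V : set X) (H : set (nat * set X)).

Local Notation conn := (conn G).
Local Notation nball := (nball G).
Local Notation gball := (gball G).

Lemma induced_setT : induced G setT = G.
Proof. by apply/seteqP; split=> -[x y] => [[]|]. Qed.

Lemma one_ended_component x F : finite_set F -> F `<=` [set y | joined G x y] ->
  exists! D, components ([set y | joined G x y] `\` F) G D /\ infinite_set D.
Proof.
move=> fF FC; set C := [set y | joined G x y].
have CC : components setT G C by exists x => //; rewrite induced_setT.
have eI : induced (induced G C) (C `\` F) = induced G (C `\` F).
  by apply/seteqP; split=> -[y z] => [[[? _] ?]|[? [[? ?] [? ?]]]].
have -> : components (C `\` F) G = components (C `\` F) (induced G C).
  by rewrite /components eI.
exact: oeG CC _ fF FC.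
Qed.

Lemma component_infinite x : infinite_set [set y | joined G x y].
Proof.
have [D [[[z [xz _] ->] infD] _]] := @one_ended_component x set0 (finite_set0 _) (@sub0set _ _).
move=> fx; apply: infD; apply: sub_finite_set fx => y /joined_induced_joined zy.
exact: joined_trans xz zy.
Qed.

Lemma joined_component V x y : joined (induced G V) x y ->
  joined (induced G [set z | joined (induced G V) x z]) x y.
Proof.
move=> j; pose S z := joined (induced G V) x z /\
  joined (induced G [set z | joined (induced G V) x z]) x z.
suff : S y by case.
apply: (joined_ind _ _ j); first by split; exact: joined_refl.
move=> z w [xz xz'] zw; have xw := joined_trans xz (joined_step zw).
split=> //; apply: joined_trans xz' _; apply: joined_step.
by case: zw => zw _; split.
Qed.

(** [K] is the component of [x] minus the unique infinite component [Y] of the complement of [K0]. A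
    connected set avoiding [K0] cannot cross between [Y] and the rest. *)
Lemma fill_holes K0 x : finite_set K0 -> conn K0 -> K0 x ->
  exists K, [/\ finite_set K, conn K, K0 `<=` K,
     conn ([set y | joined G x y] `\` K)
   & forall B, conn B -> B `&` K0 = set0 -> B `<=` K \/ B `&` K = set0].
Proof.
move=> fK0 cK0 K0x; set C := [set y | joined G x y].
have K0C : K0 `<=` C by move=> y; exact: conn_joined.
have [Y [[[z [Cz nK0z] YE] infY] uY]] := one_ended_component fK0 K0C.
pose J := joined (induced G (C `\` K0)).
have Jsym a b : J a b -> J b a by exact: joined_induced_sym.
have Jin a b : J a b -> (C `\` K0) a -> (C `\` K0) b by exact: joined_induced_mem.
have YJ y : Y y <-> J z y by rewrite YE.
have YC : Y `<=` C `\` K0 by move=> y /YJ/Jin; apply.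
have YB B : conn B -> B `&` K0 = set0 -> B `&` Y !=set0 -> B `<=` Y.
  move=> cB BK0 [b [Bb /YJ zb]] b' Bb'; apply/YJ; apply: (joined_trans zb).
  have [Cb _] : (C `\` K0) b by apply: Jin zb _.
  apply: joined_induced_sub (cB _ _ Bb Bb') => y By; split.
    by apply: (joined_trans Cb); exact: conn_joined Bb By.
  by move=> K0y; have : (B `&` K0) y by []; rewrite BK0.
have finJ w : C w -> ~ K0 w -> ~ Y w -> finite_set [set y | J w y].
  move=> Cw nK0w nYw; apply: contrapT => infw; apply: nYw.
  rewrite (uY [set y | J w y]); first exact: joined_refl.
  by split=> //; exists w.
(* A path from [w] to [x] must enter [K0]; the last vertex before the first entry is [b]. *)
have exit w : C w -> ~ K0 w -> exists b a, [/\ J w b, ~ K0 b, K0 a & G (b, a)].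
  move=> Cw nK0w.
  have wx : joined G w x by apply: joined_sym.
  pose S u := (J w u /\ ~ K0 u) \/ exists b a, [/\ J w b, ~ K0 b, K0 a & G (b, a)].
  suff : S x by case=> // -[].
  apply: (joined_ind _ _ wx); first by left; split=> //; exact: joined_refl.
  move=> u v [[wu nK0u] uv|]; last by right.
  have [K0v|nK0v] := pselect (K0 v); first by right; exists u, v.
  left; split=> //; apply: (joined_trans wu); apply: joined_step.
  have [Cu _] : (C `\` K0) u by apply: Jin wu _.
  by split=> //; split=> //; split=> //; apply: (joined_trans Cu); apply: joined_step.
exists (C `\` Y).
have CDK : C `\` (C `\` Y) = Y.
  apply/seteqP; split=> y => [[Cy nn]|Yy]; first by apply: contrapT => nY; apply: nn.
  by split; [case: (YC _ Yy)|case].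
have K0K : K0 `<=` C `\` Y by move=> y K0y; split; [exact: K0C|case/YC].
split=> //.
(* Every hole contains a vertex adjacent to [K0]. There are finitely many such vertices, and each
   hole is finite. *)
- apply: (@sub_finite_set _ _ (K0 `|`
      \bigcup_(b in nball 1 K0 `&` [set b | finite_set [set y | J b y]]) [set y | J b y])).
    move=> w [Cw nYw]; have [K0w|nK0w] := pselect (K0 w); [by left|right].
    have [b [a [wb nK0b K0a ba]]] := exit w Cw nK0w.
    have [Cb _] : (C `\` K0) b by apply: Jin wb _.
    exists b; last exact: Jsym.
    split; first by apply: nball1_adj K0a (symG ba).
    apply: finJ => // /YJ zb; apply: nYw; apply/YJ.
    exact: joined_trans zb (Jsym _ _ wb).
  rewrite finite_setU; split=> //; apply: bigcup_finite => [|b [] //].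
  by apply: sub_finite_set (nball_finite lfG 1 fK0) => y [].
- apply: (conn_star_adj symG cK0 K0K) => w [Cw nYw].
  have [K0w|nK0w] := pselect (K0 w).
    by exists K0 => //; split=> //; exists w, w; split=> //; left.
  have [b [a [wb nK0b K0a ba]]] := exit w Cw nK0w.
  exists [set y | J w y]; last first.
    by split; [exact: joined_refl|exists b, a; split=> //; right].
  split=> [y y' wy wy'|y wy].
    apply: joined_trans (joined_component wy').
    by apply: joined_induced_sym => //; exact: joined_component.
  have [Cy _] : (C `\` K0) y by apply: Jin wy _.
  split=> // /YJ zy; apply: nYw; apply/YJ.
  exact: joined_trans zy (Jsym _ _ wy).
- rewrite CDK => y y' /YJ zy /YJ zy'.
  have -> : Y = [set y | J z y] by apply/seteqP; split=> u /YJ.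
  apply: joined_trans (joined_component zy').
  by apply: joined_induced_sym => //; exact: joined_component.
- move=> B cB BK0.
  have [[b [Bb [Cb nYb]]]|nB] := pselect ((B `&` (C `\` Y)) !=set0); last first.
    by right; apply: contrapT => /eqP/set0P.
  left=> y By; split; first by apply: (joined_trans Cb); exact: conn_joined Bb By.
  move=> Yy; apply: nYb; apply: (YB _ cB BK0) Bb.
  by exists y.
Qed.

Lemma joined_within V K a b : joined (induced G V) a b -> nball 1 K a ->
  exists k, joined (induced G (nball k K `&` V)) a b.
Proof.
move=> j Ka; pose S z := exists k, nball k.+1 K z /\
  joined (induced G (nball k.+1 K `&` V)) a z.
suff [k [_ ?]] : S b by exists k.+1.
apply: (joined_ind _ _ j); first by exists 0; split=> //; exact: joined_refl.
move=> y z [k [Ky jy]] [yz [Vy Vz]].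
have kS : nball k.+1 K `<=` nball k.+2 K by exact: nball_mono.
have Kz : nball k.+2 K z.
  by have [x Kx xy] := Ky; exists x => //; right; exists y.
exists k.+1; split=> //; apply: joined_trans (joined_induced_sub _ jy) _.
  by move=> w [/kS ? ?].
by apply: joined_step; split=> //; split=> //; split=> //; exact: kS.
Qed.

(** Compatibility survives unions: a zone meeting the union meets one of the hulls and is contained
    in it. *)
Lemma compatible_hull H F : good_state G H -> finite_set F -> conn F ->
  exists Q, [/\ finite_set Q, conn Q, compatible G H Q & F `<=` Q].
Proof.
move=> [_ _ _ i3 _] fF cF; have /choice[Q QP] := i3.
have FQ : F `<=` \bigcup_(v in F) Q v.
  by move=> v Fv; exists v => //; case: (QP v).
exists (\bigcup_(v in F) Q v); split=> //.
- by apply: bigcup_finite => // v _; case: (QP v).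
- apply: (conn_star symG cF FQ) => y [v Fv Qy].
  have [_ cQ _ Qv] := QP v.
  by exists (Q v); split=> //; [move=> z Qz; exists v|exists v].
- move=> l L HL.
  have [[w [Lw [v Fv Qw]]]|nL] := pselect ((nball l L `&` \bigcup_(v in F) Q v) !=set0).
    left; have [_ _ cQ _] := QP v; have [s|e] := cQ _ _ HL.
      by move=> z /s Qz; exists v.
    by have : (nball l L `&` Q v) w by []; rewrite e.
  by right; apply: contrapT => /eqP/set0P.
Qed.

Section Separation.
Variable U : nat -> set X.
Hypothesis sepU : forall F x, finite_set F -> ~ F x ->
  exists p, U p x /\ forall y, F y -> ~ U p y.

Definition base_union (w : seq nat) : set X := [set y | exists2 p, p \in w & U p y].

(** Each point of [K] gets a basic open set that misses the finite set [nball r K] minus [K]. *)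
Lemma far_in_base_union K r : finite_set K ->
  (forall a b, K a -> K b -> gball r a b) -> exists w, far_in G r (base_union w) K.
Proof.
move=> fK dK.
have /choice[p pP] : forall a, exists p, K a -> U p a /\
    forall y, (nball r K `\` K) y -> ~ U p y.
  move=> a; have [Ka|] := pselect (K a); last by exists 0.
  have [|[] //|p pP] := @sepU (nball r K `\` K) a; last by exists p.
  by apply: sub_finite_set (nball_finite lfG r fK) => y [].
have /finite_seqP[s sK] := fK; exists (map p s); split=> //.
  move=> a Ka; exists (p a); last by case: (pP a Ka).
  by apply: map_f; move: Ka; rewrite sK.
move=> a b Ka ab [_ /mapP[c cs ->] Ub]; apply: contrapT => nKb.
have Kc : K c by rewrite sK.
have [_ h] := pP c Kc; apply: (h b) => //; split=> //.
by exists a.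
Qed.

(** Take a compatible hull of the ball and fill its holes to get [K]. Then choose [k] so large that
    the zone contains the rerouting paths, [r] so large that it accommodates a hull of the zone, and
    [w] isolating [K]. *)
Lemma candidate_exists H x n : good_state G H -> exists k r w K,
  [/\ 0 < k, candidate G H k r (base_union w) K & gball n x `<=` K].
Proof.
move=> gH; have [i0 _ _ _ _] := gH.
have [K0 [fK0 cK0 cHK0 FK0]] :=
  compatible_hull gH (gball_finite lfG n x) (gball_conn symG (k := n) (x := x)).
have K0x : K0 x by apply: FK0; exact: gball_refl.
have [K [fK cK K0K cCK hole]] := fill_holes fK0 cK0 K0x.
have Kx := K0K _ K0x.
set C := [set y | joined G x y] in cCK.
have cHK : compatible G H K.
  move=> l L HL; have [s|e] := cHK0 _ _ HL; first by left; exact: subset_trans s K0K.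
  by apply: hole e; apply: nball_conn => //; case: (i0 _ _ HL).
have cHC : compatible G H (C `\` K).
  move=> l L HL; have [s|e] := cHK _ _ HL.
    by right; apply/seteqP; split=> // y [/s ? []].
  have [[y [Ly [Cy nKy]]]|nL] := pselect ((nball l L `&` (C `\` K)) !=set0).
    left=> z Lz; split; last first.
      by move=> Kz; have : (nball l L `&` K) z by []; rewrite e.
    apply: joined_trans Cy _; apply: conn_joined Ly Lz.
    by apply: nball_conn => //; case: (i0 _ _ HL).
  by right; apply: contrapT => /eqP/set0P.
(* Rerouting is applied to the infinite complement of [K], which joins the boundary points of [K]
   off [K] and off all members. *)
have cout := conn_setD_covered symG gH cHC cCK.
have bout : nball 1 K `\` K `<=` (C `\` K) `\` covered H.
  move=> a ab; split; last exact: boundary_uncovered gH cHK ab.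
  case: ab => -[y Ky /gball_joined ya] nKa; split=> //.
  by apply: joined_trans ya; exact: conn_joined Kx Ky.
have fb : finite_set (nball 1 K `\` K).
  by apply: sub_finite_set (nball_finite lfG 1 fK) => y [].
pose S k a b := joined (induced G (nball k K `\` (K `|` covered H))) a b.
have Smono a b m l : m <= l -> S m a b -> S l a b.
  move=> ml; apply: joined_induced_sub => z [Kz nz].
  by split=> //; exact: nball_mono Kz.
have [k kP] : exists k, forall a b, (nball 1 K `\` K) a -> (nball 1 K `\` K) b -> S k a b.
  have [|a Ka|k kP] := @finite_set_bound _ _
    (fun a k => forall b, (nball 1 K `\` K) b -> S k a b) fb.
  - by move=> a m l ml h b Kb; apply: Smono ml _; exact: h.
  - apply: (@finite_set_bound _ _ (fun b k => S k a b) fb) => [b m l|b Kb]; first exact: Smono.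
    have [k kP] := joined_within (cout _ _ (bout _ Ka) (bout _ Kb)) Ka.1.
    exists k; apply: joined_induced_sub kP => z [Kz [[_ nKz] nUz]].
    by split=> // -[].
  - by exists k => a b Ka; exact: kP.
have [Q [fQ cQ cHQ KQ]] :=
  compatible_hull gH (nball_finite lfG k.+1 fK) (nball_conn symG (k := k.+1) cK).
have [r1 r1P] : exists r, forall y, Q y -> gball r x y.
  apply: (@finite_set_bound _ _ (fun y r => gball r x y) fQ) => [y m l|y Qy].
    by move=> ml; exact: gball_mono.
  apply: joined_gball; apply: conn_joined cQ _ Qy.
  by apply: KQ; exact: sub_nball.
have KQ' : K `<=` Q by move=> y Ky; apply: KQ; exact: sub_nball.
have dK a b : K a -> K b -> gball (r1 + r1) a b.
  by move=> /KQ'/r1P xa /KQ'/r1P; apply: gball_trans; exact: gball_sym.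
have [w wP] := far_in_base_union fK dK.
exists k.+1, r1, w, K; split=> //; last exact: subset_trans FK0 K0K.
split=> //; first by split=> //; exists x.
  by exists Q; split=> // y /r1P xy; exists x.
by move=> a b Ka Kb; apply: Smono (leqnSn k) _; exact: kP.
Qed.

End Separation.
End Existence.

(** * Borel partial toasts *)

Section BorelStates.
Variables (X : topologicalType) (U K : nat -> set X).
Hypotheses (baseUK : regular_base U K) (sepX : separated_points X).
Variable G : set (X * X).
Hypotheses (borelG : borel G) (symG : forall x y, G (x, y) -> G (y, x)).
Variable phi : nat -> X -> X.
Hypotheses (bphi : forall i, borel_map (phi i))
  (phiP : forall x y, joined G x y <-> exists i, phi i x = y).

Local Notation comp x := [set y | joined G x y].

Lemma phi_comp i x : comp x (phi i x).
Proof. by apply/phiP; exists i. Qed.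

Lemma borel_eq (Y : topologicalType) (f g : Y -> X) :
  borel_map f -> borel_map g -> borel [set y | f y = g y].
Proof.
have [oU _ _ _] := baseUK.
move=> bf bg; have -> : [set y | f y = g y] = [set y | ~ exists pq : nat * nat,
    (U pq.1 `&` U pq.2 = set0) /\ (U pq.1 (f y) /\ U pq.2 (g y))].
  apply/seteqP; split=> y /= => [e [[p q] /= [d [Up Uq]]]|h].
    have : (U p `&` U q) (f y) by split=> //; rewrite e.
    by rewrite d.
  apply: contrapT => /(disjoint_base baseUK sepX)[p [q [Up Uq d]]].
  by apply: h; exists (p, q).
apply: borel_not; apply: borel_exists => -[p q]; apply: borel_and.
  exact: borel_cst.
by apply: borel_and; [exact: bf|exact: bg].
Qed.

(* The finite subsets of the component of [x] are the sets [fpoints s x]. *)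
Definition fpoints (s : seq nat) (x : X) : set X :=
  [set y | exists2 i, i \in s & y = phi i x].

Lemma fpoints_finite s x : finite_set (fpoints s x).
Proof.
apply/finite_seqP; exists [seq phi i x | i <- s]; apply/seteqP; split=> y.
  by move=> [i si ->]; apply/mapP; exists i.
by move=> /mapP[i si ->]; exists i.
Qed.

Lemma fpoints_comp s x : fpoints s x `<=` comp x.
Proof. by move=> _ [i _ ->]; exact: phi_comp. Qed.

Lemma fpointsP (L : set X) x : finite_set L -> L `<=` comp x ->
  exists s, fpoints s x = L.
Proof.
move=> /finite_seqP[l ->] lx.
have /choice[i iP] : forall y, exists i, y \in l -> phi i x = y.
  move=> y; have [/lx/phiP[i]|] := boolP (y \in l); last by exists 0.
  by exists i.
exists (map i l); apply/seteqP; split=> y.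
  by move=> [_ /mapP[z zl ->] ->]; rewrite /= iP.
by move=> yl; exists (i y); [exact: map_f|rewrite iP].
Qed.

(** Quantifiers over the component of [x], or over its finite subsets, become countable through
    [phi]; this lemma and the next three are the resulting rules. *)
Lemma borel_exists_point (A : X -> X -> Prop) :
  (forall i, borel [set x | A x (phi i x)]) ->
  (forall x y, A x y -> joined G x y) -> borel [set x | exists y, A x y].
Proof.
move=> bA Aj; have -> : [set x | exists y, A x y] = [set x | exists i, A x (phi i x)].
  apply/seteqP; split=> x /= => [[y Axy]|[i Ai]]; last by exists (phi i x).
  by have /phiP[i e] := Aj _ _ Axy; exists i; rewrite e.
exact: borel_exists.
Qed.

Lemma borel_forall_point (A : X -> X -> Prop) :
  (forall i, borel [set x | A x (phi i x)]) ->
  (forall x y, ~ joined G x y -> A x y) -> borel [set x | forall y, A x y].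
Proof.
move=> bA Aj; have -> : [set x | forall y, A x y] = [set x | forall i, A x (phi i x)].
  apply/seteqP; split=> x /= h y; first exact: h.
  have [/phiP[i <-]|] := pselect (joined G x y); [exact: h|exact: Aj].
exact: borel_forall.
Qed.

Lemma borel_exists_set (A : X -> set X -> Prop) :
  (forall s, borel [set x | A x (fpoints s x)]) ->
  (forall x L, A x L -> finite_set L /\ L `<=` comp x) ->
  borel [set x | exists L, A x L].
Proof.
move=> bA Aj; have -> : [set x | exists L, A x L] = [set x | exists s, A x (fpoints s x)].
  apply/seteqP; split=> x /= => [[L AxL]|[s As]]; last by exists (fpoints s x).
  have [fL Lx] := Aj _ _ AxL.
  by have [s e] := fpointsP fL Lx; exists s; rewrite e.
exact: borel_exists.
Qed.

Lemma borel_forall_set (A : X -> set X -> Prop) :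
  (forall s, borel [set x | A x (fpoints s x)]) ->
  (forall x L, ~ (finite_set L /\ L `<=` comp x) -> A x L) ->
  borel [set x | forall L, A x L].
Proof.
move=> bA Aj; have -> : [set x | forall L, A x L] = [set x | forall s, A x (fpoints s x)].
  apply/seteqP; split=> x /= h L; first exact: h.
  have [[fL Lx]|] := pselect (finite_set L /\ L `<=` comp x); last exact: Aj.
  by have [s <-] := fpointsP fL Lx.
exact: borel_forall.
Qed.

(** A Borel assignment to [x] of a subset of its component, tested along the enumeration. *)
Definition borel_family (V : X -> set X) :=
  (forall j, borel [set x | V x (phi j x)]) /\ forall x, V x `<=` comp x.

Lemma borel_family_fpoints s : borel_family (fpoints s).
Proof.
split=> [j|x]; last exact: fpoints_comp.
have -> : [set x | fpoints s x (phi j x)] = [set x | exists i, i \in s /\ phi j x = phi i x].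
  by apply/seteqP; split=> x /= => [[i]|[i []]]; exists i.
apply: borel_exists => i; apply: borel_and; first exact: borel_cst.
exact: borel_eq.
Qed.

(** The edge set may vary with [x], so that paths inside [induced G (V x)] are covered as well. *)
Lemma borel_gball (F : X -> set (X * X)) k i j :
  (forall i j, borel [set x | F x (phi i x, phi j x)]) ->
  (forall x, F x `<=` G) -> borel [set x | gball (F x) k (phi i x) (phi j x)].
Proof.
move=> bF FG; elim: k j => [|k IH] j; first exact: borel_eq.
apply: borel_or; first exact: IH.
have -> : [set x | exists2 z, gball (F x) k (phi i x) z & F x (z, phi j x)] =
    [set x | exists z, gball (F x) k (phi i x) z /\ F x (z, phi j x)].
  by apply/seteqP; split=> x /= [z]; [move=> ? ?; exists z|move=> [? ?]; exists z].
apply: (@borel_exists_point (fun x z => gball (F x) k (phi i x) z /\ F x (z, phi j x))).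
  by move=> l; apply: borel_and; [exact: IH|exact: bF].
move=> x z [_ /FG/symG jz]; apply: joined_trans (phi_comp j x) _.
exact: joined_step.
Qed.

Lemma borel_gballG k i j : borel [set x | gball G k (phi i x) (phi j x)].
Proof.
apply: (@borel_gball (fun=> G)) => [{}i {}j|x]; last exact: subset_refl.
exact: (borel_rel baseUK).
Qed.

Lemma borel_family_nball k V : borel_family V -> borel_family (fun x => nball G k (V x)).
Proof.
move=> [bV Vx]; split=> [j|x y [z /Vx xz /gball_joined]]; last exact: joined_trans.
have -> : [set x | nball G k (V x) (phi j x)] =
    [set x | exists z, V x z /\ gball G k z (phi j x)].
  by apply/seteqP; split=> x /= [z]; [move=> ? ?; exists z|move=> [? ?]; exists z].
apply: (@borel_exists_point (fun x z => V x z /\ gball G k z (phi j x))) => [i|x z [/Vx //]].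
by apply: borel_and; [exact: bV|exact: borel_gballG].
Qed.

Lemma borel_familyD V (D : X -> set X) : borel_family V ->
  (forall j, borel [set x | D x (phi j x)]) -> borel_family (fun x => V x `\` D x).
Proof.
move=> [bV Vx] bD; split=> [j|x y []]; last by move=> /Vx.
by apply: borel_and; [exact: bV|apply: borel_not; exact: bD].
Qed.

Lemma borel_joined V i j : borel_family V ->
  borel [set x | joined (induced G (V x)) (phi i x) (phi j x)].
Proof.
move=> [bV Vx].
have -> : [set x | joined (induced G (V x)) (phi i x) (phi j x)] =
    [set x | exists k, gball (induced G (V x)) k (phi i x) (phi j x)].
  apply/seteqP; split=> x /= => [/joined_gball//|[k]].
  exact: gball_joined.
apply: borel_exists => k.
apply: (@borel_gball (fun x => induced G (V x))) => [{}i {}j|x y []//].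
apply: borel_and; first exact: (borel_rel baseUK).
by apply: borel_and; exact: bV.
Qed.

Lemma borel_pairs V V' : borel_family V -> borel_family V' ->
  borel [set x | forall a b, V x a -> V x b -> joined (induced G (V' x)) a b].
Proof.
move=> [bV Vx] fV'.
apply: (@borel_forall_point (fun x a => forall b, V x a -> V x b ->
  joined (induced G (V' x)) a b)) => [i|x a nxa b /Vx//].
apply: (@borel_forall_point (fun x b => V x (phi i x) -> V x b ->
  joined (induced G (V' x)) (phi i x) b)) => [j|x b nxb _ /Vx//].
do 2 (apply: borel_imp; first exact: bV).
exact: borel_joined.
Qed.

Lemma borel_subset V (D : X -> set X) : borel_family V ->
  (forall j, borel [set x | D x (phi j x)]) -> borel [set x | V x `<=` D x].
Proof.
move=> [bV Vx] bD.
apply: (@borel_forall_point (fun x a => V x a -> D x a)) => [i|x a nxa /Vx//].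
by apply: borel_imp; [exact: bV|exact: bD].
Qed.

Lemma borel_disjoint V (D : X -> set X) : borel_family V ->
  (forall j, borel [set x | D x (phi j x)]) -> borel [set x | V x `&` D x = set0].
Proof.
move=> fV bD.
have -> : [set x | V x `&` D x = set0] = [set x | V x `<=` ~` D x].
  by apply/seteqP; split=> x /= /disjoints_subset.
by apply: borel_subset fV _ => j; apply: borel_not; exact: bD.
Qed.

(** Finite connected nonempty sets all have the form [fpoints s x], so these preimages describe all
    members of a good state. *)
Definition borel_state (H : set (nat * set X)) :=
  forall k s, borel [set x | H (k, fpoints s x)].

Section State.
Variable H : set (nat * set X).
Hypotheses (gH : good_state G H) (bH : borel_state H).

Lemma member_comp k L x y : H (k, L) -> L y -> joined G x y -> L `<=` comp x.
Proof.
have [i0 _ _ _ _] := gH; move=> /i0[_ _ _ cL] Ly xy z Lz.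
by apply: joined_trans xy _; exact: conn_joined cL Ly Lz.
Qed.

Lemma borel_covered j : borel [set x | covered H (phi j x)].
Proof.
have [i0 _ _ _ _] := gH.
have -> : [set x | covered H (phi j x)] = [set x | exists k, exists L, H (k, L) /\ L (phi j x)].
  apply/seteqP; split=> x /= => [[[k L] HL Lx]|[k [L [HL Lx]]]]; last by exists (k, L).
  by exists k, L.
apply: borel_exists => k.
apply: (@borel_exists_set (fun x L => H (k, L) /\ L (phi j x))) => [s|x L [HL Lx]].
  by apply: borel_and; [exact: bH|exact: (borel_family_fpoints s).1].
split; first by case: (i0 _ _ HL).
exact: member_comp HL Lx (phi_comp j x).
Qed.

Lemma borel_compatible V : borel_family V -> borel [set x | compatible G H (V x)].
Proof.
have [i0 _ _ _ _] := gH.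
move=> fV; have [bV Vx] := fV; apply: borel_forall => k.
apply: (@borel_forall_set (fun x L => H (k, L) ->
    nball G k L `<=` V x \/ nball G k L `&` V x = set0)) => [s|x L nL HL].
  apply: borel_imp; first exact: bH.
  have fN := borel_family_nball k (borel_family_fpoints s).
  by apply: borel_or; [exact: borel_subset|exact: borel_disjoint].
right; apply/seteqP; split=> // y [[z Lz zy] /Vx xy]; apply: nL.
split; first by case: (i0 _ _ HL).
apply: member_comp HL Lz _; apply: joined_trans xy _.
exact: gball_joined (gball_sym symG zy).
Qed.

Lemma borel_candidate k r W s : open W ->
  borel [set x | candidate G H k r W (fpoints s x)].
Proof.
move=> oW; have fs := borel_family_fpoints s; have fN l := borel_family_nball l fs.
have [bs _] := fs.
have bW j : borel [set x | W (phi j x)] by exact: bphi.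
have -> : [set x | candidate G H k r W (fpoints s x)] = [set x |
    (((exists y, fpoints s x y) /\ conn G (fpoints s x)) /\
     ((fpoints s x `<=` W /\
       forall a b, fpoints s x a -> fpoints s x b -> gball G (r + r) a b) /\
       forall a b, fpoints s x a -> gball G (r + r) a b -> W b -> fpoints s x b)) /\
    (exists Q, (finite_set Q /\ conn G Q) /\ (compatible G H Q /\
       (nball G k (fpoints s x) `<=` Q /\ Q `<=` nball G r (fpoints s x)))) /\
    (compatible G H (fpoints s x) /\
     forall a b, (nball G 1 (fpoints s x) `\` fpoints s x) a ->
       (nball G 1 (fpoints s x) `\` fpoints s x) b ->
       joined (induced G (nball G k (fpoints s x) `\`
         (fpoints s x `|` covered H))) a b)].
  apply/seteqP; split=> x /=.
    move=> [[ne _ cs] [c1 c2 c3] [Q [fQ cQ hQ kQ Qr]] ch cj].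
    by do !split=> //; exists Q.
  move=> [[[ne cs] [[c1 c2] c3]] [[Q [[fQ cQ] [hQ [kQ Qr]]]] [ch cj]]].
  by split=> //; [split=> //; exact: fpoints_finite|exists Q].
apply: borel_and; [apply: borel_and; apply: borel_and|apply: borel_and].
- apply: (@borel_exists_point (fun x y => fpoints s x y)); first exact: bs.
  by move=> x y /fpoints_comp.
- exact: borel_pairs.
- apply: borel_and; first exact: borel_subset.
  apply: (@borel_forall_point (fun x a => forall b, fpoints s x a -> fpoints s x b ->
    gball G (r + r) a b)) => [i|x a nxa b /fpoints_comp//].
  apply: (@borel_forall_point (fun x b => fpoints s x (phi i x) -> fpoints s x b ->
    gball G (r + r) (phi i x) b)) => [j|x b nxb _ /fpoints_comp//].
  do 2 (apply: borel_imp; first exact: bs).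
  exact: borel_gballG.
- apply: (@borel_forall_point (fun x a => forall b, fpoints s x a ->
    gball G (r + r) a b -> W b -> fpoints s x b)) => [i|x a nxa b /fpoints_comp//].
  apply: (@borel_forall_point (fun x b => fpoints s x (phi i x) ->
    gball G (r + r) (phi i x) b -> W b -> fpoints s x b)) => [j|x b nxb _].
    apply: borel_imp; first exact: bs.
    apply: borel_imp; first exact: borel_gballG.
    by apply: borel_imp; [exact: bW|exact: bs].
  move=> /gball_joined ib; exfalso; apply: nxb.
  exact: joined_trans (phi_comp i x) ib.
- apply: (@borel_exists_set (fun x Q => (finite_set Q /\ conn G Q) /\ (compatible G H Q /\
       (nball G k (fpoints s x) `<=` Q /\ Q `<=` nball G r (fpoints s x))))).
    move=> t; have ft := borel_family_fpoints t; have [bt _] := ft.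
    apply: borel_and; apply: borel_and.
    + have -> : [set x | finite_set (fpoints t x)] = [set x | True].
        by apply/seteqP; split=> // x _; exact: fpoints_finite.
      exact: borel_cst.
    + exact: borel_pairs.
    + exact: borel_compatible.
    + apply: borel_and; first exact: borel_subset (fN k) bt.
      exact: borel_subset ft (fN r).1.
  move=> x Q [[fQ _] [_ [_ Qr]]]; split=> //.
  by apply: subset_trans Qr _; exact: (fN r).2.
- apply: borel_and; first exact: borel_compatible fs.
  apply: borel_pairs; apply: borel_familyD => // j.
  by apply: borel_or; [exact: bs|exact: borel_covered].
Qed.

Lemma borel_state_extend k r W : open W -> borel_state (extend G H k r W).
Proof.
move=> oW l s.
have -> : [set x | extend G H k r W (l, fpoints s x)] =
  [set x | H (l, fpoints s x) \/ (l = k /\ candidate G H k r W (fpoints s x))] by [].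
apply: borel_or; first exact: bH.
by apply: borel_and; [exact: borel_cst|exact: borel_candidate].
Qed.

End State.

End BorelStates.

(** * The generic toast *)

Section GenericToast.
Variables (X : topologicalType) (U K : nat -> set X).
Hypotheses (baseUK : regular_base U K) (sepX : separated_points X).
Hypothesis baireX : forall W : set X, open W -> W !=set0 -> ~ meagre W.
Variable G : set (X * X).
Hypotheses (borelG : borel G) (symG : forall x y, G (x, y) -> G (y, x)).
Hypotheses (lfG : locally_finite G) (oeG : one_ended setT G).
Variable phi : nat -> X -> X.
Hypotheses (bphi : forall i, borel_map (phi i))
  (phiP : forall x y, joined G x y <-> exists i, phi i x = y).

Definition nice_state (H : set (nat * set X)) :=
  good_state G H /\ borel_state phi H.

(** The second condition freezes what lies inside an old member, so (T3) passes to the limit. *)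
Definition prolongs (H H' : set (nat * set X)) := H `<=` H' /\
  forall L L', members H L -> members H' L' -> L' `<=` L -> members H L'.

Definition swallowed (T : set (set X)) n : set X :=
  [set x | exists L, T L /\ gball G n x `<=` L].

Lemma open_base_union w : open (base_union U w).
Proof.
have [oU _ _ _] := baseUK.
have -> : base_union U w = \bigcup_(p in [set` w]) U p.
  by apply/seteqP; split=> x [p pw px]; exists p.
by apply: bigcup_open => p _.
Qed.

(* Each [x] in [U p] is handled by one of countably many choices of parameters,
   so one choice handles a nonmeagre set of points. *)
Lemma prolong_nonmeagre H n p : nice_state H -> exists H',
  [/\ nice_state H', prolongs H H'
    & U p !=set0 -> ~ meagre (swallowed (members H') n `&` U p)].
Proof.
have [oU _ _ _] := baseUK.
move=> [gH bH].
have [Up0|nUp] := pselect (U p !=set0); last by exists H; split=> //; split.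
pose ext (c : nat * nat * seq nat) :=
  extend G H c.1.1.+1 c.1.2 (base_union U c.2).
have [c cP] : exists c, ~ meagre (swallowed (members (ext c)) n `&` U p).
  apply: contrapT => /forallNP h; apply: baireX (oU p) Up0 _.
  apply: (@meagre_sub _ _ (\bigcup_c (swallowed (members (ext c)) n `&` U p))).
    move=> x Ux.
    have [[|k] [r [w [L [k0 cL xL]]]]] //:=
      candidate_exists symG lfG oeG (separate_finite baseUK sepX) x n gH.
    exists (k, r, w) => //; split=> //; exists L; split=> //.
    by exists k.+1; right.
  by apply: meagre_bigcup => c; apply: contrapT; exact: h.
exists (ext c); split=> //; split.
- apply: good_state_extend => //; exact: component_infinite oeG.
- apply: (borel_state_extend baseUK) => //; exact: open_base_union.
- by move=> L HL; left.
- by move=> L L'; exact: extend_no_submember.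
Qed.

(** Dovetailing: the pair of a radius [n] and a basic open set [U p] is treated at the step numbered
    by its code. *)
Lemma exists_stages : exists Hs : nat -> set (nat * set X),
  [/\ forall n, nice_state (Hs n), forall n, prolongs (Hs n) (Hs n.+1)
    & forall n p, U p !=set0 -> exists m, ~ meagre (swallowed (members (Hs m)) n `&` U p)].
Proof.
have /choice[next nextP] : forall c : nat * nat * set (nat * set X), exists H',
    nice_state c.2 -> [/\ nice_state H', prolongs c.2 H'
    & U c.1.2 !=set0 -> ~ meagre (swallowed (members H') c.1.1 `&` U c.1.2)].
  move=> [[n p] H]; have [nH|] := pselect (nice_state H); last by exists H.
  by have [H' H'P] := prolong_nonmeagre n p nH; exists H'.
pose task k : nat * nat := odflt (0, 0) (unpickle k).
pose Hs := fix Hs n := if n is n'.+1 then next (task n', Hs n') else set0.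
have nHs n : nice_state (Hs n).
  elim: n => [|n IH]; last by have [] := nextP (task n, Hs n) IH.
  split; first exact: good_state0.
  by move=> k s; exact: (borel_cst False).
exists Hs; split=> // [n|n p Up]; first by have [] := nextP (task n, Hs n) (nHs n).
exists (pickle (n, p)).+1.
have tE : task (pickle (n, p)) = (n, p) by rewrite /task pickleK.
have [_ _ h] := nextP (n, p, Hs (pickle (n, p))) (nHs _).
by rewrite /= tE; exact: h.
Qed.

(** * The limit of the stages *)

Section Limit.
Variable Hs : nat -> set (nat * set X).
Hypotheses (niceHs : forall n, nice_state (Hs n))
  (prolHs : forall n, prolongs (Hs n) (Hs n.+1))
  (nmHs : forall n p, U p !=set0 ->
     exists m, ~ meagre (swallowed (members (Hs m)) n `&` U p)).

Definition limit_members : set (set X) := \bigcup_n members (Hs n).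

Lemma stages_mono m n L : m <= n -> members (Hs m) L -> members (Hs n) L.
Proof.
move=> mn mL; elim: n mn => [|n IH]; first by rewrite leqn0 => /eqP <-.
rewrite leq_eqVlt => /orP[/eqP <-//|/IH[k HL]].
by exists k; have [+ _] := prolHs n; apply.
Qed.

Lemma stages_no_submember m L L' : members (Hs m) L -> limit_members L' ->
  L' `<=` L -> members (Hs m) L'.
Proof.
move=> mL [n _ mL'] L'L.
have [nm|/ltnW mn] := leqP n m; first exact: stages_mono mL'.
rewrite -(subnKC mn) in mL'; elim: (n - m) mL' => [|d IH]; first by rewrite addn0.
rewrite addnS => mL'; apply: IH; have [_ h] := prolHs (m + d).
by apply: h mL' L'L; apply: stages_mono mL; exact: leq_addr.
Qed.

Lemma limit_memberP L : limit_members L -> [/\ L !=set0, finite_set L & conn G L].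
Proof.
by move=> [n _ [k HL]]; have [[i0 _ _ _ _] _] := niceHs n; have [] := i0 _ _ HL.
Qed.

Lemma borel_limit_members s : borel [set x | limit_members (fpoints phi s x)].
Proof.
have -> : [set x | limit_members (fpoints phi s x)] =
    [set x | exists n, exists k, Hs n (k, fpoints phi s x)].
  by apply/seteqP; split=> x /= => [[n _ [k HL]]|[n [k HL]]]; exists n => //; exists k.
by apply: borel_exists => n; apply: borel_exists => k; case: (niceHs n).
Qed.

Lemma borel_swallowed n : borel (swallowed limit_members n).
Proof.
apply: (borel_exists_set phiP (A := fun x L => limit_members L /\ gball G n x `<=` L)).
  move=> s; apply: borel_and; first exact: borel_limit_members.
  apply: (borel_subset (phi := phi) phiP (V := gball G n)).
    split=> [j|x y /gball_joined//].
    (* The centre [x] is rewritten as some [phi i x], with [i] depending on [x], to fit the rules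
       for enumerated points. *)
    have -> : [set x | gball G n x (phi j x)] =
        [set x | exists i, phi i x = x /\ gball G n (phi i x) (phi j x)].
      apply/seteqP; split=> x /= => [h|[k [e]]]; last by rewrite e.
      have /phiP[k e] := joined_refl G x.
      by exists k; rewrite e.
    apply: borel_exists => k; apply: borel_and.
      by apply: (borel_eq baseUK) => //; exact: borel_map_id.
    exact: (borel_gballG baseUK).
  by move=> j; exact: (borel_family_fpoints baseUK sepX bphi phiP s).1.
move=> x L [mL xL]; have [_ fL cL] := limit_memberP mL; split=> // y Ly.
by apply: (conn_joined cL) => //; apply: xL; exact: gball_refl.
Qed.

Definition generic_part : set X := \bigcap_n swallowed limit_members n.

Lemma borel_generic_part : borel generic_part.
Proof.
have -> : generic_part = [set x | forall n, swallowed limit_members n x].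
  by apply/seteqP; split=> x h n => [|_]; exact: h.
by apply: borel_forall => n; exact: borel_swallowed.
Qed.

(** For each radius the set of swallowed points is Borel and nonmeagre in every nonempty open set,
    hence comeagre. *)
Lemma comeagre_generic_part : comeagre generic_part.
Proof.
have [_ _ UK bUK] := baseUK.
rewrite /comeagre setC_bigcap; apply: meagre_bigcup => n.
apply: comeagre_nonmeagre => [|W oW [x Wx] mW]; first exact: borel_swallowed.
have [p [px pW]] := bUK _ _ oW Wx.
have [|m] := @nmHs n p; first by exists x.
apply; apply: meagre_sub mW => y [[L [mL yL]] Uy]; split; last exact/pW/UK.
by exists L; split=> //; exists m.
Qed.

Lemma generic_part_joined x y : joined G x y -> generic_part x -> generic_part y.
Proof.
move=> /joined_gball[k xy] gx n _; have [L [mL xL]] := gx (k + n) I.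
exists L; split=> // z yz; apply: xL; exact: gball_trans xy yz.
Qed.

Lemma invariant_generic_part : invariant setT G generic_part.
Proof.
exists [set C | components setT G C /\ C `<=` generic_part]; first by move=> C [].
apply/seteqP; split=> [x gx|x [C [_ sub] Cx]]; last exact: sub.
exists [set y | joined (induced G setT) x y]; last exact: joined_refl.
split; first by exists x.
by move=> y; rewrite /= induced_setT => xy; exact: generic_part_joined gx.
Qed.

Definition generic_toast : set (set X) :=
  [set L | limit_members L /\ L `<=` generic_part].

Lemma generic_toastP L x : limit_members L -> L x -> generic_part x -> generic_toast L.
Proof.
move=> mL Lx gx; split=> // y Ly; have [_ _ cL] := limit_memberP mL.
by apply: generic_part_joined gx; exact: conn_joined cL Lx Ly.
Qed.

(** A member is connected, so all coordinates of a tuple listing it are values [phi (s i)] at the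
    first coordinate; there are countably many choices of [s]. *)
Lemma borel_generic_toast : borel_collection generic_toast.
Proof.
have bT s : borel [set x | generic_toast (fpoints phi s x)].
  apply: borel_and; first exact: borel_limit_members.
  have -> : [set x | fpoints phi s x `<=` generic_part] =
      [set x | forall i, i \in s -> generic_part (phi i x)].
    apply/seteqP; split=> x /= => [h i si|h _ [i si ->]]; last exact: h.
    by apply: h; exists i.
  apply: borel_forall => i; apply: borel_imp; first exact: borel_cst.
  exact: (borel_preimage (bphi i)) borel_generic_part.
case=> [|n].
  (* The empty tuple lists the empty set, which is never a member. *)
  have -> : [set x : {ptws 'I_0 -> X} | generic_toast (range x)] = [set _ | False].
    by apply/seteqP; split=> // x [/limit_memberP[[y [[]]]]].
  exact: borel_cst.
have bproj i : borel_map (fun x : {ptws 'I_n.+1 -> X} => x i).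
  by apply: continuous_borel_map; exact: (@proj_continuous _ (fun=> X) i).
have -> : [set x : {ptws 'I_n.+1 -> X} | generic_toast (range x)] =
    [set x | exists s : {ffun 'I_n.+1 -> nat},
      (forall i, x i = phi (s i) (x ord0)) /\
      generic_toast (fpoints phi (codom s) (x ord0))].
  have fx (x : {ptws 'I_n.+1 -> X}) (s : {ffun 'I_n.+1 -> nat}) :
      (forall i, x i = phi (s i) (x ord0)) ->
      range x = fpoints phi (codom s) (x ord0).
    move=> sP; apply/seteqP; split=> y.
      by move=> [i _ <-]; exists (s i); [exact: codom_f|exact: sP].
    by move=> [_ /codomP[i ->] ->]; exists i.
  apply/seteqP; split=> x /=; last by move=> [s [/fx -> ]].
  move=> gx; have [mx _] := gx; have [_ _ cx] := limit_memberP mx.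
  have /choice[s sP] : forall i, exists k, phi k (x ord0) = x i.
    move=> i; apply/phiP; apply: conn_joined cx _ _; first by exists ord0.
    by exists i.
  exists (finfun s); rewrite -fx; last by move=> i; rewrite ffunE sP.
  by split=> // i; rewrite ffunE sP.
apply: borel_exists => s; apply: borel_and; last first.
  exact: (borel_preimage (bproj ord0)) (bT (codom s)).
apply: borel_forall => i; apply: (borel_eq baseUK sepX) => //.
exact: borel_map_comp (bphi (s i)) (bproj ord0).
Qed.

(** (T1) uses radius 1 at an endpoint of the edge, (T2) is read off at a common stage, and (T3) at
    any stage containing the member. *)
Lemma connected_toast_generic :
  connected_toast generic_part (induced G generic_part) generic_toast.
Proof.
set E := induced G generic_part.
have B1E L : B1 E L `<=` nball G 1 L.
  move=> y [Ly|[x Lx [xy _]]]; first exact: sub_nball.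
  exact: nball1_adj Lx xy.
split; first split.
- by move=> L [mL sub]; have [_ fL _] := limit_memberP mL.
- exact: borel_generic_toast.
- apply/seteqP; split=> [xy [L _ []]//|[x y] [Gxy [gx gy]]].
  have [L [mL xL]] := gx 1 I.
  have Lx : L x by apply: xL; exact: gball_refl.
  exists L; first exact: generic_toastP mL Lx gx.
  by do !split=> //; apply: xL; right; exists x.
- move=> L L' [[m _ mL] _] [[n _ mL'] _] LL'.
  have [[_ i1 _ _ _] _] := niceHs (maxn m n).
  have [] := i1 _ _ (stages_mono (leq_maxl m n) mL) (stages_mono (leq_maxr m n) mL') LL'.
  + move=> e; apply: Or31; apply/seteqP; split=> // z [/B1E Lz L'z].
    by rewrite -e.
  + by move=> sub; apply: Or32; exact: subset_trans (B1E L) sub.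
  + by move=> sub; apply: Or33; exact: subset_trans (B1E L') sub.
- move=> L [[n _ mL] sub].
  have [[_ _ _ _ i4] _] := niceHs n.
  have -> : \bigcup_(L0 in [set L0 | generic_toast L0 /\ L0 `<` L]) L0 =
      proper_cover (members (Hs n)) L.
    congr bigcup; apply/seteqP; split=> L' /= [].
      move=> [mL' _] L'L; split=> //; apply: stages_no_submember mL mL' _.
      exact: properW.
    move=> mL' L'L; split=> //; split; first by exists n.
    by apply: subset_trans sub; exact: properW.
  move=> x y Lx Ly; apply: joined_sub (i4 _ mL _ _ Lx Ly) => -[z w] [zw [Lz Lw]].
  by split=> //; split=> //; split; [case: Lz|case: Lw] => /sub.
Qed.

End Limit.

End GenericToast.

Theorem theorem3p3 (R : realType) (X : topologicalType) (hX : polish R X)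
    (G : set (X * X)) (hG : borel_graph G) (lfG : locally_finite G)
    (oeG : one_ended setT G) :
  exists X' : set X,
    [/\ invariant setT G X', comeagre X', borel X'
      & exists T : set (set X), connected_toast X' (induced G X') T].
Proof.
(* The empty space is treated apart, since listing a dense set as a sequence requires a point. *)
have [[x0 _]|nX] := pselect (exists x : X, True); last first.
  have e (A : set X) : A = set0.
    by apply/seteqP; split=> // x; exfalso; apply: nX; exists x.
  exists set0; split.
  - by exists set0 => //; rewrite bigcup_set0.
  - rewrite /comeagre (e (~` _)); apply: nowhere_dense_meagre.
    by rewrite /nowhere_dense (e (interior _)).
  - exact: (borel_cst False).
  - exists set0; split=> //; split=> //.
    + by move=> n; exact: (borel_cst False).
    + by apply/seteqP; split=> -[x y]; exfalso; apply: nX; exists x.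
have [P [U [K [schemeP sepX baseUK baireX]]]] := polish_structure x0 hX.
have [_ symG bG] := hG.
have [phi [bphi phiP]] := component_enumeration baseUK schemeP sepX bG lfG.
have [Hs [nHs pHs mHs]] :=
  exists_stages baseUK sepX baireX bG symG lfG oeG bphi phiP.
exists (generic_part G Hs); split.
- exact: invariant_generic_part.
- exact: (comeagre_generic_part baseUK sepX bG symG bphi phiP).
- exact: (borel_generic_part baseUK sepX bG symG bphi phiP).
- exists (generic_toast G Hs).
  exact: (connected_toast_generic baseUK sepX bG symG bphi phiP).
Qed.
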